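(* For every $p\in\mathbb{R}^d\setminus\{0\}$, the series $\sum_{q\in\Lambda_p}\hat S(q)$ converges absolutely and $$H(p)^2 \;=\; 2d\,\exp\Big(\sum_{q\in\Lambda_p}\hat S(q)\Big)\,|p|^2 .$$
   Context: Let $d\ge1$. For $u:\mathbb{Z}^d\to\mathbb{R}$ the discrete Laplacian is $\Delta u(x)=\sum_{i=1}^d\big(u(x+e_i)+u(x-e_i)-2u(x)\big)$. For $p\in\mathbb{R}^d\setminus\{0\}$, the problem: $\Delta u(x)=0$ for $p\cdot x>0$, $u(x)=0$ for $p\cdot x\le 0$, $\sup_{p\cdot x>0}|u(x)-p\cdot x|<\infty$, has a unique solution $u_p:\mathbb{Z}^d\to\mathbb{R}$, and the Hamiltonian is defined by $H(p)=\Delta u_p(0)$. For $p\in\mathbb{R}^d\setminus\{0\}$ let $\Lambda_p=\{q\in\mathbb{Z}^d: p\cdot q=0\}$. Let $S$ be the $2\pi\mathbb{Z}^d$-periodic function $S(\theta)=\log\big(1-\frac1d\sum_{j=1}^d\cos\theta_j\big)$ (with a logarithmic singularity at $\theta\in2\pi\mathbb{Z}^d$), and $\hat S(q)=(2\pi)^{-d}\int_{[-\pi,\pi]^d}S(\theta)e^{-iq\cdot\theta}\,d\theta$ for $q\in\mathbb{Z}^d$ its Fourier coefficients. *)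

(* Defs.v *)
From Stdlib Require Import Reals Lra Lia ZArith Arith List.
Open Scope R_scope.

(* Points of Z^d are functions nat -> Z; only coordinates 0..d-1 are used.
   inZd d x : x is supported on the coordinates 0..d-1. *)
Definition inZd (d : nat) (x : nat -> Z) : Prop :=
  forall i, (d <= i)%nat -> x i = 0%Z.

Definition zeroZ : nat -> Z := fun _ => 0%Z.

Definition sumR (d : nat) (f : nat -> R) : R :=
  fold_right Rplus 0 (map f (seq 0 d)).

Definition dotRZ (d : nat) (p : nat -> R) (x : nat -> Z) : R :=
  sumR d (fun i => p i * IZR (x i)).

Definition normsq (d : nat) (p : nat -> R) : R := sumR d (fun i => p i ^ 2).

Definition shift (x : nat -> Z) (i : nat) (s : Z) : nat -> Z :=
  fun j => if Nat.eqb j i then (x j + s)%Z else x j.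

Definition lap (d : nat) (u : (nat -> Z) -> R) (x : nat -> Z) : R :=
  sumR d (fun i => u (shift x i 1) + u (shift x i (-1)) - 2 * u x).

Definition is_sol (d : nat) (p : nat -> R) (u : (nat -> Z) -> R) : Prop :=
  (forall x, inZd d x -> dotRZ d p x > 0 -> lap d u x = 0) /\
  (forall x, inZd d x -> dotRZ d p x <= 0 -> u x = 0) /\
  (exists C, forall x, inZd d x -> dotRZ d p x > 0 ->
       Rabs (u x - dotRZ d p x) <= C).

Fixpoint msum (d : nat) (r : list Z) (f : (nat -> Z) -> R) : R :=
  match d with
  | O => f zeroZ
  | S d' => fold_right Rplus 0
             (map (fun z => msum d' r (fun x => f (fun j => if Nat.eqb j d' then z else x j))) r)
  end.

Definition grid (N : nat) : list Z := map Z.of_nat (seq 0 N).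
Definition box (M : nat) : list Z :=
  map (fun k => (Z.of_nat k - Z.of_nat M)%Z) (seq 0 (2 * M + 1)).

Definition Strunc (d : nat) (eps : R) (th : nat -> R) : R :=
  ln (Rmax (1 - / INR d * sumR d (fun j => cos (th j))) eps).

Definition theta (N : nat) (k : nat -> Z) : nat -> R :=
  fun j => - PI + 2 * PI * IZR (k j) / INR N.

Definition phase (d : nat) (q : nat -> Z) (th : nat -> R) : R :=
  sumR d (fun j => IZR (q j) * th j).

(* Riemann sums for (2pi)^{-d} int_{[-pi,pi]^d} S_eps(th) e^{-i q.th} dth:
   real part (cos) and imaginary part (-sin). *)
Definition RS_re (d : nat) (eps : R) (q : nat -> Z) (N : nat) : R :=
  / (INR N ^ d) * msum d (grid N)
     (fun k => Strunc d eps (theta N k) * cos (phase d q (theta N k))).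
Definition RS_im (d : nat) (eps : R) (q : nat -> Z) (N : nat) : R :=
  / (INR N ^ d) * msum d (grid N)
     (fun k => - (Strunc d eps (theta N k) * sin (phase d q (theta N k)))).

(* re + i im is the Fourier coefficient \hat S(q): the integral is the
   limit (eps = 1/(m+2) -> 0) of the Riemann integrals of the continuous
   truncations, each computed as the limit of Riemann sums. *)
Definition is_Fourier (d : nat) (q : nat -> Z) (re im : R) : Prop :=
  exists Ire Iim : nat -> R,
    (forall m, Un_cv (fun N => RS_re d (/ INR (m + 2)) q (S N)) (Ire m)) /\
    (forall m, Un_cv (fun N => RS_im d (/ INR (m + 2)) q (S N)) (Iim m)) /\
    Un_cv Ire re /\ Un_cv Iim im.

Definition boxsum (d : nat) (p : nat -> R) (M : nat) (f : (nat -> Z) -> R) : R :=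
  msum d (box M) (fun q => if Req_EM_T (dotRZ d p q) 0 then f q else 0).

(* Main.v *)
From Stdlib Require Import Reals Lra Lia ZArith Arith List FunctionalExtensionality.
From Coquelicot Require Import Coquelicot.
(* [Defs] comes last because the Stdlib also exports a [shift]. *)
Require Import Defs.
Open Scope R_scope.

(** The projection p.X_n of simple random walk on Z^d is a symmetric random walk Y_n on R with
    variance sigma^2 = |p|^2/d per step. With phi = (1/d) sum_j cos theta_j, expanding
    log (1 - phi) shows that the sum of the Fourier coefficients over Lambda_p is
    -sum_n P(Y_n = 0)/n. For 0 < s < 1 let A be the generating measure of the walk
    killed outside (0, oo), A' its reflection, and W, W' the laws of the exit positions, weighted by
    s^time. Then A (delta - sP) = delta - W gives A' (delta - W) = A A' (delta - sP) = A (delta - W');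
    the left side is carried by y <= 0 and the right side by y >= 0, so both equal c(s) delta_0.
    Differentiating in s yields c(s) = exp (- sum_n s^n P(Y_n = 0)/n). Testing the factorisation on 1
    and y^2, with w(s) the mean of -W, gives
      s sigma^2 c(s) = 2 w(s)^2 + O (sqrt (1 - s)),
    while optional stopping for the solution u gives w(s) -> Delta u (0) / 2d. Since w is bounded
    below, so is c, whence sum_n P(Y_n = 0)/n converges, and s -> 1 gives the formula. The Fourier
    coefficients are computed exactly on powers of phi, where the Riemann sums are eventually
    return probabilities; Bernstein polynomials handle the truncated logarithm. *)

(** * Finite sums *)

(** Since [p] is an arbitrary real vector, the values [p.x] may be dense in the line and cannot be
    indexed by integers. Measures are therefore replaced by linear functionals on all functions,
    built from finitely many point evaluations, and Fubini becomes the algebraic statement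
    [commuting]. Identities between generating measures are tested at one power of [s] at a time,
    hence the space-time test functions; convergence is discussed only for numerical series. The
    error in the [y^2] identity is small because jumps are bounded: exit positions lie in a fixed
    window below 0, while the mass [b] of [delta - W] satisfies [b^2 = (1 - s) c] with [c <= 1]. The
    lower bound on [w] comes from the exits at time 1 and does not involve [u], so return
    probabilities are summable for every nonzero [p]. Taken at [p = (1, ..., 1)], this also controls
    the returns of the lattice walk to the origin, on which the Fourier half rests: the truncated
    logarithm is compared with [ln (1 - s phi)] for [s = 1 - eps], and the error is an Abel mean of
    those returns. *)

Lemma sumR_S n f : sumR (S n) f = sumR n f + f n.
Proof.
  unfold sumR. rewrite seq_S, map_app, fold_right_app. cbn [map fold_right]. rewrite Nat.add_0_l.
  generalize (map f (seq 0 n)) as l. induction l as [|a l IH]; simpl; [ring|].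
  rewrite IH. ring.
Qed.

Lemma sumR_ext n f g : (forall i, (i < n)%nat -> f i = g i) -> sumR n f = sumR n g.
Proof.
  induction n as [|n IH]; intros H; [reflexivity|].
  rewrite !sumR_S, IH by (intros; apply H; lia). now rewrite H by lia.
Qed.

Lemma sumR_plus n f g : sumR n (fun i => f i + g i) = sumR n f + sumR n g.
Proof. induction n as [|n IH]; [unfold sumR; simpl; ring|]. rewrite !sumR_S, IH. ring. Qed.

Lemma sumR_scal n c f : sumR n (fun i => c * f i) = c * sumR n f.
Proof. induction n as [|n IH]; [unfold sumR; simpl; ring|]. rewrite !sumR_S, IH. ring. Qed.

Lemma sumR_const n c : sumR n (fun _ => c) = INR n * c.
Proof. induction n as [|n IH]; [unfold sumR; simpl; ring|]. rewrite sumR_S, IH, S_INR. ring. Qed.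

Lemma sumR_le n f g : (forall i, (i < n)%nat -> f i <= g i) -> sumR n f <= sumR n g.
Proof.
  induction n as [|n IH]; intros H; [unfold sumR; simpl; lra|].
  rewrite !sumR_S. apply Rplus_le_compat; [apply IH; intros; apply H; lia | apply H; lia].
Qed.

Lemma sumR_0 n f : (forall i, (i < n)%nat -> f i = 0) -> sumR n f = 0.
Proof. intros H. rewrite (sumR_ext n f (fun _ => 0)) by exact H. rewrite sumR_const. ring. Qed.

Lemma sumR_ge0 n f : (forall i, (i < n)%nat -> 0 <= f i) -> 0 <= sumR n f.
Proof.
  intros H. rewrite <- (sumR_0 n (fun _ => 0)) by reflexivity. now apply sumR_le.
Qed.

Lemma sumR_single n f k : (k < n)%nat -> (forall i, (i < n)%nat -> i <> k -> f i = 0) ->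
  sumR n f = f k.
Proof.
  induction n as [|n IH]; intros Hk H; [lia|]. rewrite sumR_S.
  destruct (Nat.eq_dec k n) as [->|Hne].
  - rewrite sumR_0; [ring|]. intros i Hi; apply H; lia.
  - rewrite IH by (try lia; intros; apply H; lia). rewrite (H n) by lia. ring.
Qed.

Lemma sumR_ge_term n f k : (k < n)%nat -> (forall i, (i < n)%nat -> 0 <= f i) -> f k <= sumR n f.
Proof.
  intros Hk H. induction n as [|n IH]; [lia|]. rewrite sumR_S.
  pose proof (H n ltac:(lia)) as Hn. destruct (Nat.eq_dec k n) as [->|Hne].
  - assert (0 <= sumR n f) by (apply sumR_ge0; intros; apply H; lia). lra.
  - assert (f k <= sumR n f) by (apply IH; [lia|intros; apply H; lia]). lra.
Qed.

Lemma sumR_head n f : sumR (S n) f = f 0%nat + sumR n (fun i => f (S i)).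
Proof.
  induction n as [|n IH]; [unfold sumR; simpl; ring|].
  rewrite sumR_S, IH, (sumR_S n). ring.
Qed.

Lemma sumR_f_R0 n f : sumR (S n) f = sum_f_R0 f n.
Proof. induction n as [|n IH]; [unfold sumR; simpl; ring|]. rewrite sumR_S, IH. reflexivity. Qed.

(** * Linear functionals *)

(** Plays the role of integration against a finitely supported signed measure. *)
Definition linear_fn {T : Type} (L : (T -> R) -> R) : Prop :=
  (forall f g, L (fun t => f t + g t) = L f + L g) /\
  (forall c f, L (fun t => c * f t) = c * L f).

Lemma linear_fn_0 {T} (L : (T -> R) -> R) : linear_fn L -> L (fun _ => 0) = 0.
Proof.
  intros [_ H]. transitivity (L (fun _ => 0 * 0)); [f_equal; extensionality t; ring|].
  rewrite (H 0 (fun _ => 0)). ring.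
Qed.

Lemma linear_fn_sumR {T} (L : (T -> R) -> R) n (F : nat -> T -> R) : linear_fn L ->
  L (fun t => sumR n (fun i => F i t)) = sumR n (fun i => L (F i)).
Proof.
  intros HL. induction n as [|n IH]; [apply (linear_fn_0 L HL)|].
  rewrite sumR_S, <- IH. rewrite <- (proj1 HL). f_equal. extensionality t. apply sumR_S.
Qed.

Lemma linear_fn_sub {T} (L : (T -> R) -> R) f g : linear_fn L ->
  L (fun t => f t - g t) = L f - L g.
Proof.
  intros [Ha Hs]. replace (L f - L g) with (L f + (-1) * L g) by ring.
  rewrite <- Hs, <- Ha. f_equal. extensionality t. ring.
Qed.

(** Fubini's theorem for the two functionals. *)
Definition commuting {X Y : Type} (L : (X -> R) -> R) (M : (Y -> R) -> R) : Prop :=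
  forall F : X -> Y -> R, L (fun x => M (fun y => F x y)) = M (fun y => L (fun x => F x y)).

(** * Killed chains *)

(* [kill P chi x0 n g] is E[g(Y_n); Y_1, ..., Y_n in {chi = 1}] for the chain with transition
   operator [P] started at [x0]. *)
Fixpoint kill {X : Type} (P : (X -> R) -> X -> R) (chi : X -> R) (x0 : X) (n : nat)
  (g : X -> R) : R :=
  match n with
  | O => g x0
  | S n' => kill P chi x0 n' (P (fun x => chi x * g x))
  end.

(* The coefficient of s^n in (delta - W)(g), where W is the generating function of the law of the
   first exit from {chi = 1}. *)
Definition exitc {X : Type} (P : (X -> R) -> X -> R) (chi : X -> R) (x0 : X) (n : nat)
  (g : X -> R) : R :=
  match n with
  | O => g x0
  | S n' => - kill P chi x0 n' (P (fun x => (1 - chi x) * g x))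
  end.

Definition linear_op {X : Type} (P : (X -> R) -> X -> R) : Prop :=
  forall x, linear_fn (fun f => P f x).

Lemma kill_linear {X} (P : (X -> R) -> X -> R) chi x0 n : linear_op P ->
  linear_fn (kill P chi x0 n).
Proof.
  intros HP. induction n as [|n [IHa IHs]]; [split; reflexivity|].
  split; intros; cbn [kill].
  - rewrite <- IHa. f_equal. extensionality x. rewrite <- (proj1 (HP x)). f_equal.
    extensionality y. ring.
  - rewrite <- IHs. f_equal. extensionality x. rewrite <- (proj2 (HP x)). f_equal.
    extensionality y. ring.
Qed.

Lemma exitc_linear {X} (P : (X -> R) -> X -> R) chi x0 n : linear_op P ->
  linear_fn (exitc P chi x0 n).
Proof.
  intros HP. destruct n as [|n]; [split; reflexivity|].
  destruct (kill_linear P chi x0 n HP) as [Ha Hs].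
  split; intros; cbn [exitc].
  - rewrite <- Ropp_plus_distr, <- Ha. f_equal. f_equal. extensionality x.
    rewrite <- (proj1 (HP x)). f_equal. extensionality y. ring.
  - rewrite Ropp_mult_distr_r_reverse, <- Hs. f_equal. f_equal. extensionality x.
    rewrite <- (proj2 (HP x)). f_equal. extensionality y. ring.
Qed.

(** Coefficient of [s^(n+1)] in [A (delta - sP) = delta - W]: after a free step the walk has either
    survived or exited, and [exitc] carries the minus sign of [- W]. *)
Lemma kill_step {X} (P : (X -> R) -> X -> R) chi x0 n g : linear_op P ->
  kill P chi x0 n (P g) = kill P chi x0 (S n) g - exitc P chi x0 (S n) g.
Proof.
  intros HP. cbn [kill exitc]. rewrite Rminus_def, Ropp_involutive.
  rewrite <- (proj1 (kill_linear P chi x0 n HP)). f_equal. extensionality x.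
  rewrite <- (proj1 (HP x)). f_equal. extensionality y. ring.
Qed.

Lemma kill_ext {X} (P : (X -> R) -> X -> R) chi x0 n f g :
  f x0 = g x0 -> (forall x, chi x <> 0 -> f x = g x) -> kill P chi x0 n f = kill P chi x0 n g.
Proof.
  intros H0 H. destruct n as [|n]; [exact H0|]. cbn [kill]. do 2 f_equal. extensionality x.
  destruct (Req_dec (chi x) 0) as [E|E]; [rewrite E; ring|now rewrite H].
Qed.

(** From time 1 on, only points of {chi <> 0} are charged. Time 0 is different: the walk starts at
    0, which lies outside both half-lines [ispos] and [isneg]. *)
Lemma kill_S_ext {X} (P : (X -> R) -> X -> R) chi x0 n f g :
  (forall x, chi x <> 0 -> f x = g x) -> kill P chi x0 (S n) f = kill P chi x0 (S n) g.
Proof.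
  intros H. cbn [kill]. do 2 f_equal. extensionality x.
  destruct (Req_dec (chi x) 0) as [E|E]; [rewrite E; ring|now rewrite H].
Qed.

Lemma exitc_ext {X} (P : (X -> R) -> X -> R) chi x0 n f g :
  f x0 = g x0 -> (forall x, chi x <> 1 -> f x = g x) -> exitc P chi x0 n f = exitc P chi x0 n g.
Proof.
  intros H0 H. destruct n as [|n]; [exact H0|]. cbn [exitc]. do 3 f_equal. extensionality x.
  destruct (Req_dec (chi x) 1) as [E|E]; [rewrite E; ring|now rewrite H].
Qed.

(** Fubini for the transition operator. The type [T] varies because the other functional may be a
    potential on space-time or a sum over a grid. *)
Definition op_commutes {X : Type} (P : (X -> R) -> X -> R) : Prop :=
  forall (T : Type) (L : (T -> R) -> R) (F : X -> T -> R) x, linear_fn L ->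
    P (fun x => L (F x)) x = L (fun t => P (fun x => F x t) x).

Lemma kill_commutes {X} (P : (X -> R) -> X -> R) chi x0 n : op_commutes P ->
  forall (T : Type) (L : (T -> R) -> R), linear_fn L -> commuting (kill P chi x0 n) L.
Proof.
  intros HP. induction n as [|n IH]; intros T L HL F; [reflexivity|]. cbn [kill].
  rewrite <- (IH T L HL). f_equal. extensionality x.
  rewrite <- (HP T L (fun x t => chi x * F x t) x HL). f_equal. extensionality y.
  now rewrite (proj2 HL).
Qed.

(** Relative to a domain because lattice points are encoded as functions on [nat], and what is known
    of a solution concerns [inZd] only. *)
Definition monotone_on {X : Type} (D : X -> Prop) (P : (X -> R) -> X -> R) : Prop :=
  forall f g, (forall y, D y -> f y <= g y) -> forall x, D x -> P f x <= P g x.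

Lemma kill_le {X} (P : (X -> R) -> X -> R) (D : X -> Prop) chi x0 n f g :
  monotone_on D P -> (forall x, 0 <= chi x) -> D x0 ->
  f x0 <= g x0 -> (forall x, D x -> 0 < chi x -> f x <= g x) ->
  kill P chi x0 n f <= kill P chi x0 n g.
Proof.
  intros HP Hc HD. revert f g. induction n as [|n IH]; intros f g H0 H; [exact H0|]. cbn [kill].
  assert (A : forall y, D y -> chi y * f y <= chi y * g y).
  { intros y Hy. destruct (Hc y) as [E|E]; [|rewrite <- E; lra].
    apply Rmult_le_compat_l; [lra|auto]. }
  apply IH; intros; apply HP; auto.
Qed.

Lemma kill_S_le {X} (P : (X -> R) -> X -> R) (D : X -> Prop) chi x0 n f g :
  monotone_on D P -> (forall x, 0 <= chi x) -> D x0 ->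
  (forall x, D x -> 0 < chi x -> f x <= g x) ->
  kill P chi x0 (S n) f <= kill P chi x0 (S n) g.
Proof.
  intros HP Hc HD H. cbn [kill]. assert (A : forall y, D y -> chi y * f y <= chi y * g y).
  { intros y Hy. destruct (Hc y) as [E|E]; [|rewrite <- E; lra].
    apply Rmult_le_compat_l; [lra|auto]. }
  apply (kill_le P D); auto.
Qed.

Lemma kill_vanish {X} (P : (X -> R) -> X -> R) chi x0 n f : linear_op P ->
  f x0 = 0 -> (forall x, chi x <> 0 -> f x = 0) -> kill P chi x0 n f = 0.
Proof.
  intros HP H0 H. rewrite (kill_ext P chi x0 n f (fun _ => 0)) by auto.
  apply linear_fn_0, kill_linear, HP.
Qed.

Lemma kill_S_vanish {X} (P : (X -> R) -> X -> R) chi x0 n f : linear_op P ->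
  (forall x, chi x <> 0 -> f x = 0) -> kill P chi x0 (S n) f = 0.
Proof.
  intros HP H. rewrite (kill_S_ext P chi x0 n f (fun _ => 0)) by auto.
  apply linear_fn_0, kill_linear, HP.
Qed.

Lemma exitc_vanish {X} (P : (X -> R) -> X -> R) chi x0 n f : linear_op P ->
  f x0 = 0 -> (forall x, chi x <> 1 -> f x = 0) -> exitc P chi x0 n f = 0.
Proof.
  intros HP H0 H. rewrite (exitc_ext P chi x0 n f (fun _ => 0)) by auto.
  apply linear_fn_0, exitc_linear, HP.
Qed.

(** * The projected walk on the real line *)

Definition stepR (d : nat) (p : nat -> R) (g : R -> R) (y : R) : R :=
  / (2 * INR d) * sumR d (fun i => g (y + p i) + g (y - p i)).

Definition ispos (y : R) : R := if Rlt_dec 0 y then 1 else 0.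
Definition isneg (y : R) : R := if Rlt_dec y 0 then 1 else 0.
Definition ind0 (y : R) : R := if Req_EM_T y 0 then 1 else 0.

Lemma stepR_linear d p : linear_op (stepR d p).
Proof.
  intros y. unfold stepR. split; intros.
  - rewrite <- Rmult_plus_distr_l, <- sumR_plus. f_equal. apply sumR_ext. intros. ring.
  - rewrite (sumR_ext d _ (fun i => c * (f (y + p i) + f (y - p i)))) by (intros; ring).
    rewrite sumR_scal. ring.
Qed.

Lemma stepR_commutes d p : op_commutes (stepR d p).
Proof.
  intros T L F y HL. unfold stepR. rewrite (proj2 HL). f_equal.
  rewrite (linear_fn_sumR L d (fun i t => F (y + p i) t + F (y - p i) t) HL).
  apply sumR_ext. intros. symmetry. apply (proj1 HL).
Qed.

Lemma inv_2d_ge0 d : 0 <= / (2 * INR d).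
Proof.
  destruct (pos_INR d) as [H|H].
  - left. apply Rinv_0_lt_compat. lra.
  (* The case [d = 0], where [/ 0 = 0]. *)
  - rewrite <- H, Rmult_0_r, Rinv_0. lra.
Qed.

Lemma stepR_le d p f g y : (forall x, f x <= g x) -> stepR d p f y <= stepR d p g y.
Proof.
  intros H. unfold stepR. apply Rmult_le_compat_l; [apply inv_2d_ge0|].
  apply sumR_le. intros. apply Rplus_le_compat; apply H.
Qed.

Lemma stepR_opp d p g y : stepR d p g (- y) = stepR d p (fun x => g (- x)) y.
Proof.
  unfold stepR. f_equal. apply sumR_ext. intros i _. rewrite Rplus_comm.
  f_equal; f_equal; ring.
Qed.

(** The steps are symmetric, so the walk killed outside the negative half-line is the mirror image
    of the one killed outside the positive half-line; the primed measures of the overview are thus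
    the [isneg] versions. *)
Lemma kill_neg d p n g :
  kill (stepR d p) isneg 0 n g = kill (stepR d p) ispos 0 n (fun y => g (- y)).
Proof.
  revert g. induction n as [|n IH]; intros g; cbn [kill]; [now rewrite Ropp_0|].
  rewrite IH. f_equal. extensionality y. rewrite stepR_opp. f_equal. extensionality x.
  f_equal. unfold ispos, isneg. destruct (Rlt_dec (- x) 0), (Rlt_dec 0 x); try reflexivity; lra.
Qed.

(** * Wiener-Hopf factorisation *)

(* Test functions live on space-time [R * nat]; functionals are truncated at time [N] and are
   only applied to test functions vanishing after time [N]. *)
Definition stepST (d : nat) (p : nat -> R) (g : R * nat -> R) (z : R * nat) : R :=
  stepR d p (fun y => g (y, S (snd z))) (fst z).

(** Applying two functionals in turn to [translate z g] tests their convolution on [g]. Times add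
    along with positions, as exponents of [s] do in a product. *)
Definition translate (z : R * nat) (g : R * nat -> R) (w : R * nat) : R :=
  g (fst z + fst w, (snd z + snd w)%nat).

Definition pot (d : nat) (p : nat -> R) (chi : R -> R) (N : nat) (g : R * nat -> R) : R :=
  sumR (S N) (fun n => kill (stepR d p) chi 0 n (fun y => g (y, n))).

Definition exitpot (d : nat) (p : nat -> R) (chi : R -> R) (N : nat) (g : R * nat -> R) : R :=
  sumR (S N) (fun n => exitc (stepR d p) chi 0 n (fun y => g (y, n))).

Lemma pot_linear d p chi N : linear_fn (pot d p chi N).
Proof.
  unfold pot. split; intros.
  - rewrite <- sumR_plus. apply sumR_ext. intros n _.
    apply (proj1 (kill_linear _ chi 0 n (stepR_linear d p))).
  - rewrite <- sumR_scal. apply sumR_ext. intros n _.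
    apply (proj2 (kill_linear _ chi 0 n (stepR_linear d p))).
Qed.

Lemma pot_commutes d p chi N {T} (L : (T -> R) -> R) : linear_fn L ->
  commuting (pot d p chi N) L.
Proof.
  intros HL F. unfold pot. rewrite (linear_fn_sumR L (S N)
    (fun n t => kill (stepR d p) chi 0 n (fun y => F (y, n) t)) HL).
  apply sumR_ext. intros n _.
  apply (kill_commutes _ chi 0 n (stepR_commutes d p) T L HL (fun y => F (y, n))).
Qed.

(** Summing [kill_step] over time telescopes; the boundary term sits at time [S N], where [g]
    vanishes. *)
Lemma pot_resolvent d p chi N g : (forall y n, (N < n)%nat -> g (y, n) = 0) ->
  pot d p chi N (fun z => g z - stepST d p g z) = exitpot d p chi N g.
Proof.
  intros Hg. unfold pot, exitpot, stepST. cbn [fst snd].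
  assert (E : forall M, sumR M (fun n => kill (stepR d p) chi 0 n
             (fun y => g (y, n) - stepR d p (fun y => g (y, S n)) y))
     = sumR M (fun n => exitc (stepR d p) chi 0 n (fun y => g (y, n)))
       - (kill (stepR d p) chi 0 M (fun y => g (y, M))
          - exitc (stepR d p) chi 0 M (fun y => g (y, M)))).
  { induction M as [|M IH]; [unfold sumR; simpl; ring|]. rewrite !sumR_S, IH.
    rewrite (linear_fn_sub _ (fun y => g (y, M)) (stepR d p (fun y => g (y, S M)))
               (kill_linear _ chi 0 M (stepR_linear d p))).
    rewrite kill_step by apply stepR_linear. ring. }
  rewrite E, kill_vanish, exitc_vanish; try (intros; apply Hg; lia); try apply stepR_linear.
  ring.
Qed.

Definition conv_pot (d : nat) (p : nat -> R) (N : nat) (h : R * nat -> R) : R :=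
  pot d p ispos N (fun z => pot d p isneg N (translate z h)).

Lemma conv_pot_linear d p N : linear_fn (conv_pot d p N).
Proof.
  unfold conv_pot. split; intros.
  - rewrite <- (proj1 (pot_linear d p ispos N)). f_equal. extensionality z.
    apply (proj1 (pot_linear d p isneg N)).
  - rewrite <- (proj2 (pot_linear d p ispos N)). f_equal. extensionality z.
    apply (proj2 (pot_linear d p isneg N)).
Qed.

Lemma conv_pot_sym d p N h :
  conv_pot d p N h = pot d p isneg N (fun w => pot d p ispos N (translate w h)).
Proof.
  unfold conv_pot.
  etransitivity; [apply (pot_commutes d p ispos N (pot d p isneg N) (pot_linear d p isneg N))|].
  f_equal. extensionality w. f_equal. extensionality z. unfold translate.
  now rewrite Rplus_comm, Nat.add_comm.
Qed.

Lemma translate_resolvent d p z g :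
  translate z (fun w => g w - stepST d p g w)
  = (fun w => translate z g w - stepST d p (translate z g) w).
Proof.
  extensionality w. unfold translate, stepST, stepR. cbn [fst snd]. do 2 f_equal.
  apply sumR_ext. intros i _. rewrite Nat.add_succ_r. f_equal; do 2 f_equal; ring.
Qed.

Lemma translate_pot_resolvent d p chi N z g : (forall y n, (N < n)%nat -> g (y, n) = 0) ->
  pot d p chi N (translate z (fun w => g w - stepST d p g w)) = exitpot d p chi N (translate z g).
Proof.
  intros Hg. rewrite translate_resolvent. apply pot_resolvent.
  intros y n Hn. unfold translate. cbn [fst snd]. apply Hg. lia.
Qed.

Lemma conv_pot_resolvent d p N g : (forall y n, (N < n)%nat -> g (y, n) = 0) ->
  conv_pot d p N (fun z => g z - stepST d p g z)
  = pot d p ispos N (fun z => exitpot d p isneg N (translate z g)).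
Proof.
  intros Hg. unfold conv_pot. f_equal. extensionality z. now apply translate_pot_resolvent.
Qed.

Lemma conv_pot_resolvent_sym d p N g : (forall y n, (N < n)%nat -> g (y, n) = 0) ->
  conv_pot d p N (fun z => g z - stepST d p g z)
  = pot d p isneg N (fun z => exitpot d p ispos N (translate z g)).
Proof.
  intros Hg. rewrite conv_pot_sym. f_equal. extensionality z. now apply translate_pot_resolvent.
Qed.

Lemma exitpot_neg_vanish d p N z g :
  (forall y n, 0 <= y -> g (fst z + y, n) = 0) -> exitpot d p isneg N (translate z g) = 0.
Proof.
  intros H. apply sumR_0. intros n _. unfold translate. cbn [fst snd].
  apply exitc_vanish; [apply stepR_linear| |].
  - apply H. lra.
  - intros y Hy. apply H. unfold isneg in Hy. destruct (Rlt_dec y 0); lra.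
Qed.

Lemma exitpot_pos_vanish d p N z g :
  (forall y n, y <= 0 -> g (fst z + y, n) = 0) -> exitpot d p ispos N (translate z g) = 0.
Proof.
  intros H. apply sumR_0. intros n _. unfold translate. cbn [fst snd].
  apply exitc_vanish; [apply stepR_linear| |].
  - apply H. lra.
  - intros y Hy. apply H. unfold ispos in Hy. destruct (Rlt_dec 0 y); lra.
Qed.

Lemma ispos_neq0 y : ispos y <> 0 -> 0 < y.
Proof. unfold ispos. destruct (Rlt_dec 0 y); lra. Qed.

Lemma isneg_neq0 y : isneg y <> 0 -> y < 0.
Proof. unfold isneg. destruct (Rlt_dec y 0); lra. Qed.

Lemma ind0_neq y : y <> 0 -> ind0 y = 0.
Proof. unfold ind0. now destruct (Req_EM_T y 0). Qed.

Lemma ind0_0 : ind0 0 = 1.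
Proof. unfold ind0. now destruct (Req_EM_T 0 0). Qed.

(** The coefficient of [s^n] in [c(s)], read off as the mass that [delta - W'] has at 0. *)
Definition kappa (d : nat) (p : nat -> R) (n : nat) : R := exitc (stepR d p) isneg 0 n ind0.

Lemma kappa_0 d p : kappa d p 0 = 1.
Proof. apply ind0_0. Qed.

(* The left-hand side is carried by [y >= 0] by [conv_pot_resolvent], and by [y <= 0] by
   [conv_pot_resolvent_sym]. *)
Lemma wiener_hopf d p N g : (forall y n, (N < n)%nat -> g (y, n) = 0) ->
  conv_pot d p N (fun z => g z - stepST d p g z) = sumR (S N) (fun n => kappa d p n * g (0, n)).
Proof.
  intros Hg.
  (* The test function is split by the sign of the position: one form of the left-hand side
     annihilates [gn], the other annihilates [gp]. *)
  set (gp := fun z : R * nat => ispos (fst z) * g z).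
  set (gn := fun z : R * nat => isneg (fst z) * g z).
  set (g0 := fun z : R * nat => ind0 (fst z) * g z).
  assert (Hdec : forall z, g z = gn z + (g0 z + gp z)).
  { intros [y n]. unfold gn, g0, gp, ispos, isneg, ind0. cbn [fst].
    destruct (Rlt_dec y 0), (Rlt_dec 0 y), (Req_EM_T y 0); try lra. }
  assert (Hlin : forall a b, stepST d p (fun z => a z + b z)
                  = (fun z => stepST d p a z + stepST d p b z)).
  { intros. extensionality z. unfold stepST. apply (proj1 (stepR_linear d p (fst z))). }
  transitivity (conv_pot d p N (fun z => gn z - stepST d p gn z)
    + (conv_pot d p N (fun z => g0 z - stepST d p g0 z)
       + conv_pot d p N (fun z => gp z - stepST d p gp z))).
  { rewrite <- !(proj1 (conv_pot_linear d p N)). f_equal. extensionality z.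
    replace g with (fun z => gn z + (g0 z + gp z)) by (extensionality w; now rewrite <- Hdec).
    rewrite (Hlin gn), (Hlin g0). ring. }
  rewrite (conv_pot_resolvent d p N gn), (conv_pot_resolvent d p N g0),
    (conv_pot_resolvent_sym d p N gp); try (intros; unfold gn, gp, g0; rewrite Hg by lia; ring).
  assert (E1 : pot d p ispos N (fun z => exitpot d p isneg N (translate z gn)) = 0).
  { apply sumR_0. intros n _.
    assert (A : forall x, 0 <= x -> exitpot d p isneg N (translate (x, n) gn) = 0).
    { intros x Hx. apply exitpot_neg_vanish. intros y m Hy. unfold gn, isneg. cbn [fst].
      cbn [fst] in *. destruct (Rlt_dec (x + y) 0); [lra|ring]. }
    apply kill_vanish; [apply stepR_linear|apply A; lra|].
    intros x Hx%ispos_neq0. apply A. lra. }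
  assert (E2 : pot d p isneg N (fun z => exitpot d p ispos N (translate z gp)) = 0).
  { apply sumR_0. intros n _.
    assert (A : forall x, x <= 0 -> exitpot d p ispos N (translate (x, n) gp) = 0).
    { intros x Hx. apply exitpot_pos_vanish. intros y m Hy. unfold gp, ispos. cbn [fst].
      cbn [fst] in *. destruct (Rlt_dec 0 (x + y)); [lra|ring]. }
    apply kill_vanish; [apply stepR_linear|apply A; lra|].
    intros x Hx%isneg_neq0. apply A. lra. }
  (* For [g0] only time 0 of the outer potential remains: later it charges [x > 0], and adding an
     exit position [y >= 0] never gives 0. *)
  rewrite E1, E2, Rplus_0_l, Rplus_0_r. unfold pot. rewrite sumR_head. cbn [kill].
  rewrite (sumR_0 N), Rplus_0_r.
  - apply sumR_ext. intros n _. unfold translate, g0, kappa. cbn [fst snd].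
    rewrite Rmult_comm, <- (proj2 (exitc_linear _ isneg 0 n (stepR_linear d p))). f_equal.
    extensionality y. rewrite !Rplus_0_l, Nat.add_0_l. rewrite Rmult_comm.
    destruct (Req_dec y 0) as [->|E]; [ring|]. rewrite !(ind0_neq y) by exact E. ring.
  - intros m _. apply kill_S_vanish; [apply stepR_linear|]. intros x Hx%ispos_neq0.
    apply exitpot_neg_vanish. intros y n Hy. cbn [fst]. unfold g0. cbn [fst].
    rewrite ind0_neq by lra. ring.
Qed.

(** A test function living at time [N] alone extracts the coefficient of [s^N] from
    [A (delta - W') = c(s) delta_0]. *)
Lemma wiener_hopf_coeff d p N G :
  sumR (S N) (fun m => kill (stepR d p) ispos 0 m
     (fun x => exitc (stepR d p) isneg 0 (N - m) (fun y => G (x + y)))) = kappa d p N * G 0.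
Proof.
  set (g := fun z : R * nat => if Nat.eqb (snd z) N then G (fst z) else 0).
  assert (Hg : forall y n, (N < n)%nat -> g (y, n) = 0).
  { intros y n Hn. unfold g. cbn [snd]. destruct (Nat.eqb_spec n N); [lia|reflexivity]. }
  pose proof (wiener_hopf d p N g Hg) as E. rewrite conv_pot_resolvent in E by exact Hg.
  rewrite (sumR_single (S N) _ N) in E; [|lia|].
  - unfold g at 2 in E. cbn [snd fst] in E. rewrite Nat.eqb_refl in E. rewrite <- E.
    apply sumR_ext. intros m Hm. f_equal. extensionality x. unfold exitpot.
    rewrite (sumR_single (S N) _ (N - m)); [|lia|].
    + f_equal. extensionality y. unfold translate, g. cbn [fst snd].
      destruct (Nat.eqb_spec (m + (N - m)) N); [reflexivity|lia].
    + intros n _ Hn. apply exitc_vanish; [apply stepR_linear| |intros y _]; unfold translate, g;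
        cbn [fst snd]; destruct (Nat.eqb_spec (m + n) N); (reflexivity || lia).
  - intros n _ Hn. unfold g. cbn [snd]. destruct (Nat.eqb_spec n N); [lia|ring].
Qed.

(* [ret k y] is the probability that the walk started at [y] is at 0 at time [k]. *)
Definition ret (d : nat) (p : nat -> R) (k : nat) : R -> R := Nat.iter k (stepR d p) ind0.

(* Logarithmic derivative of the factorisation in the time variable: the terms in which the
   derivative falls on a potential do not charge [y = 0]. *)
Lemma kappa_recursion d p N :
  INR N * kappa d p N = - sumR N (fun n => kappa d p n * ret d p (N - n) 0).
Proof.
  set (e := fun z : R * nat => if Nat.eqb (snd z) N then ind0 (fst z) else 0).
  (* Multiplying a test function by the time is the adjoint of [s d/ds]. *)
  set (ne := fun z : R * nat => INR (snd z) * e z).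
  set (h := fun z : R * nat => e z - stepST d p e z).
  (* [G] is the sum over [k >= 1] of the k-th iterate of [stepST] on [e]; hence
     [G - stepST G = stepST e], and the factorisation evaluates [stepST e] through [G]. *)
  set (G := fun z : R * nat => if Nat.ltb (snd z) N then ret d p (N - snd z) (fst z) else 0).
  assert (He : forall y n, (N < n)%nat -> e (y, n) = 0).
  { intros y n Hn. unfold e. cbn [snd]. destruct (Nat.eqb_spec n N); [lia|reflexivity]. }
  assert (He0 : forall y n, y <> 0 -> e (y, n) = 0).
  { intros y n Hy. unfold e. cbn [fst snd]. rewrite ind0_neq by exact Hy.
    now destruct (Nat.eqb n N). }
  assert (Hne : forall y n, (N < n)%nat -> ne (y, n) = 0).
  { intros y n Hn. unfold ne. rewrite He by exact Hn. ring. }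
  assert (HG : forall y n, (N < n)%nat -> G (y, n) = 0).
  { intros y n Hn. unfold G. cbn [snd]. destruct (Nat.ltb_spec n N); [lia|reflexivity]. }
  assert (Z0 : forall y, stepR d p (fun _ => 0) y = 0).
  { intros y. apply (linear_fn_0 _ (stepR_linear d p y)). }
  assert (EG : (fun z => G z - stepST d p G z) = stepST d p e).
  { extensionality z. destruct z as [y n]. unfold stepST, G, e. cbn [fst snd].
    destruct (Nat.ltb_spec n N) as [H1|H1]; destruct (Nat.ltb_spec (S n) N) as [H2|H2];
      destruct (Nat.eqb_spec (S n) N) as [H3|H3]; try lia.
    - replace (N - n)%nat with (S (N - S n)) by lia. rewrite Z0.
      change (ret d p (S (N - S n)) y) with (stepR d p (ret d p (N - S n)) y).
      unfold Rminus. apply Rplus_opp_r.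
    - replace (N - n)%nat with 1%nat by lia. rewrite Z0. rewrite Rminus_0_r. reflexivity.
    - rewrite Z0. ring. }
  assert (T1 : pot d p ispos N (fun z => INR (snd z) * pot d p isneg N (translate z h)) = 0).
  { unfold pot at 1. rewrite sumR_head. cbn [kill snd INR]. rewrite Rmult_0_l, Rplus_0_l.
    apply sumR_0. intros m _. apply kill_S_vanish; [apply stepR_linear|].
    intros x Hx%ispos_neq0. unfold h. rewrite translate_pot_resolvent by exact He.
    rewrite exitpot_neg_vanish; [ring|]. intros y n Hy. apply He0. cbn [fst]. lra. }
  assert (T2 : pot d p isneg N (fun z => INR (snd z) * pot d p ispos N (translate z h)) = 0).
  { unfold pot at 1. rewrite sumR_head. cbn [kill snd INR]. rewrite Rmult_0_l, Rplus_0_l.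
    apply sumR_0. intros m _. apply kill_S_vanish; [apply stepR_linear|].
    intros x Hx%isneg_neq0. unfold h. rewrite translate_pot_resolvent by exact He.
    rewrite exitpot_pos_vanish; [ring|]. intros y n Hy. apply He0. cbn [fst]. lra. }
  (* Leibniz rule: the time of a convolution is the sum of the two times, which distributes the
     derivative over [A] and [A']. *)
  assert (T3 : conv_pot d p N (fun z => INR (snd z) * h z) = 0).
  { transitivity (pot d p ispos N (fun z => INR (snd z) * pot d p isneg N (translate z h))
      + pot d p ispos N (fun z => pot d p isneg N (fun w => INR (snd w) * translate z h w))).
    - rewrite <- (proj1 (pot_linear d p ispos N)). unfold conv_pot. f_equal. extensionality z.
      rewrite <- (proj2 (pot_linear d p isneg N)), <- (proj1 (pot_linear d p isneg N)). f_equal.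
      extensionality w. unfold translate. cbn [snd]. rewrite plus_INR. ring.
    - rewrite T1, Rplus_0_l, <- T2.
      etransitivity; [apply (pot_commutes d p ispos N (pot d p isneg N) (pot_linear d p isneg N))|].
      f_equal. extensionality w. rewrite (proj2 (pot_linear d p ispos N)). do 2 f_equal.
      extensionality z. unfold translate. now rewrite Rplus_comm, Nat.add_comm. }
  pose proof (wiener_hopf d p N ne Hne) as E1.
  pose proof (wiener_hopf d p N G HG) as E2. rewrite EG in E2.
  (* The derivative of [delta - sP] itself: [stepST] reads [ne] at time [S n = n + 1], and the extra
     1 produces [- stepST e]. *)
  assert (E3 : (fun z => ne z - stepST d p ne z)
               = (fun z => INR (snd z) * h z - stepST d p e z)).
  { extensionality z. destruct z as [y n]. unfold h, ne, stepST. cbn [fst snd].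
    rewrite (proj2 (stepR_linear d p y)), S_INR. ring. }
  rewrite E3, (linear_fn_sub _ _ _ (conv_pot_linear d p N)), T3, E2 in E1.
  rewrite (sumR_single (S N) (fun n => kappa d p n * ne (0, n)) N) in E1; [|lia|].
  - unfold ne, e in E1. cbn [fst snd] in E1. rewrite Nat.eqb_refl, ind0_0 in E1.
    replace (INR N * kappa d p N) with (kappa d p N * (INR N * 1)) by ring. rewrite <- E1.
    rewrite sumR_S. unfold G at 2. cbn [snd]. rewrite Nat.ltb_irrefl.
    rewrite (sumR_ext N _ (fun n => kappa d p n * ret d p (N - n) 0)); [ring|].
    intros n Hn. unfold G. cbn [fst snd]. destruct (Nat.ltb_spec n N); [reflexivity|lia].
  - intros n _ Hn. unfold ne, e. cbn [snd]. destruct (Nat.eqb_spec n N); [lia|ring].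
Qed.

(** * Power series *)

(** A growth class with radius of convergence at least 1 that is wide enough for the second moment
    of the killed walk, bounded linearly in time. *)
Definition lin_bounded (a : nat -> R) : Prop := exists C, forall n, Rabs (a n) <= C * (INR n + 1).

(** For [s <= 1], [n s^n] is at most the geometric sum [1 + ... + s^(n-1)]. This yields the radius
    of convergence below and the dominating sequence in [green_abel_lim]. *)
Lemma pow_mul_bound s n : 0 <= s <= 1 -> INR n * s ^ n * (1 - s) <= 1 - s ^ n.
Proof.
  intros Hs. induction n as [|n IH]; [simpl; lra|].
  rewrite S_INR. assert (H0 : 0 <= s ^ S n <= 1).
  { split; [apply pow_le; lra|]. rewrite <- (pow1 (S n)). apply pow_incr; lra. }
  assert (H1 : s * (INR n * s ^ n * (1 - s)) <= s * (1 - s ^ n))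
    by (apply Rmult_le_compat_l; lra).
  assert (H2 : 0 <= (1 - s) * (1 - s ^ S n)) by (apply Rmult_le_pos; lra).
  simpl in *. nra.
Qed.

Lemma lin_bounded_radius a s : lin_bounded a -> Rabs s < 1 -> Rbar_lt (Rabs s) (CV_radius a).
Proof.
  intros [C HC] Hs. pose proof (Rabs_pos s) as Hp. set (r := (1 + Rabs s) / 2).
  assert (Hr : Rabs s < r < 1) by (unfold r; lra).
  apply Rbar_lt_le_trans with (y := Finite r); [exact (proj1 Hr)|].
  apply (proj1 (CV_radius_bounded a)). exists (C * / (1 - r)). intros n.
  rewrite Rabs_mult, (Rabs_pos_eq (r ^ n)) by (apply pow_le; lra).
  assert (HC0 : 0 <= C) by (pose proof (HC 0%nat) as H; pose proof (Rabs_pos (a 0%nat)); simpl in H; lra).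
  apply Rle_trans with (C * (INR n + 1) * r ^ n).
  { apply Rmult_le_compat_r; [apply pow_le; lra|apply HC]. }
  rewrite Rmult_assoc. apply Rmult_le_compat_l; [exact HC0|].
  apply Rmult_le_reg_r with (1 - r); [lra|]. rewrite Rinv_l by lra.
  pose proof (pow_mul_bound r n ltac:(lra)). assert (0 <= r ^ n) by (apply pow_le; lra). nra.
Qed.

Lemma lin_bounded_ex a s : lin_bounded a -> Rabs s < 1 -> ex_pseries a s.
Proof. intros Ha Hs. apply CV_radius_inside. now apply lin_bounded_radius. Qed.

Lemma bounded_lin a C : (forall n, Rabs (a n) <= C) -> lin_bounded a.
Proof.
  intros H. exists C. intros n. pose proof (pos_INR n). pose proof (H 0%nat).
  pose proof (Rabs_pos (a 0%nat)). specialize (H n). nra.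
Qed.

(* The hypothesis on [kap] is the coefficientwise form of the equation [kap' = - rho * kap]. *)
Lemma PSeries_exp kap rho s : lin_bounded kap -> lin_bounded rho -> kap 0%nat = 1 ->
  (forall n, INR (S n) * kap (S n) = - PS_mult kap rho n) -> Rabs s < 1 ->
  PSeries kap s = exp (- Series (fun n => rho n / INR (S n) * s ^ S n)).
Proof.
  (* [l] is the primitive of [rho], with constant term 0 because division by 0 gives 0. The product
     of the series of [kap] with [exp] of that of [l] then has derivative 0. *)
  intros Hk Hrho Hk0 Hode Hs. set (l := fun n => rho (pred n) / INR n).
  assert (Hl : lin_bounded l).
  { destruct Hrho as [C HC]. exists C. intros n. unfold l.
    assert (HC0 : 0 <= C) by (pose proof (HC 0%nat) as H; pose proof (Rabs_pos (rho 0%nat)); simpl in H; lra).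
    destruct n as [|n].
    - simpl. rewrite Rdiv_0_r, Rabs_R0. lra.
    - assert (H0 : 1 <= INR (S n)) by (rewrite S_INR; pose proof (pos_INR n); lra).
      unfold Rdiv. rewrite Rabs_mult, (Rabs_pos_eq (/ INR (S n)))
        by (left; apply Rinv_0_lt_compat; lra).
      apply Rmult_le_reg_r with (INR (S n)); [lra|]. rewrite Rmult_assoc, Rinv_l by lra.
      rewrite Rmult_1_r. eapply Rle_trans; [apply HC|]. cbn [pred]. rewrite S_INR in *. nra. }
  assert (Hd : forall t, Rabs t < 1 ->
    is_derive (fun t => PSeries kap t * exp (PSeries l t)) t 0).
  { intros t Ht.
    assert (E1 : PSeries (PS_derive kap) t = - (PSeries kap t * PSeries rho t)).
    { rewrite <- PSeries_mult by now apply lin_bounded_radius.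
      rewrite <- PSeries_opp. apply PSeries_ext. intros n. unfold PS_derive.
      rewrite Hode. reflexivity. }
    assert (E2 : PSeries (PS_derive l) t = PSeries rho t).
    { apply PSeries_ext. intros n. unfold PS_derive, l. cbn [pred]. field. apply not_0_INR. lia. }
    evar_last.
    { apply @is_derive_mult.
      - apply is_derive_PSeries. now apply lin_bounded_radius.
      - apply @is_derive_comp; [apply is_derive_exp|].
        apply is_derive_PSeries. now apply lin_bounded_radius.
      - exact Rmult_comm. }
    rewrite E1, E2. unfold scal, plus, mult; simpl. unfold mult; simpl. ring. }
  assert (E : PSeries kap s * exp (PSeries l s) = 1).
  { transitivity (PSeries kap 0 * exp (PSeries l 0)).
    - apply Rabs_def2 in Hs. destruct (Rtotal_order s 0) as [H|[->|H]]; [| reflexivity|].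
      + apply (eq_is_derive (fun t => PSeries kap t * exp (PSeries l t)) s 0); [|exact H].
        intros t Ht. apply Hd. apply Rabs_def1; lra.
      + symmetry. apply (eq_is_derive (fun t => PSeries kap t * exp (PSeries l t)) 0 s); [|exact H].
        intros t Ht. apply Hd. apply Rabs_def1; lra.
    - rewrite !PSeries_0, Hk0. unfold l. simpl. rewrite Rdiv_0_r, exp_0. ring. }
  assert (E0 : Series (fun n => rho n / INR (S n) * s ^ S n) = PSeries l s).
  { rewrite PSeries_decr_1 by now apply lin_bounded_ex. replace (l 0%nat) with 0 by (unfold l; simpl; now rewrite Rdiv_0_r).
    rewrite Rplus_0_l. unfold PSeries. rewrite <- Series_scal_l. apply Series_ext.
    intros n. unfold PS_decr_1, l. cbn [pred]. change (s ^ S n) with (s * s ^ n). ring. }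
  rewrite E0. clear E0.
  rewrite exp_Ropp. apply Rmult_eq_reg_r with (exp (PSeries l s)); [|apply Rgt_not_eq, exp_pos].
  rewrite E. field. apply Rgt_not_eq, exp_pos.
Qed.

Lemma ex_pseries_R a s : ex_pseries a s -> ex_series (fun n => a n * s ^ n).
Proof. intros [l Hl]. exists l. now apply is_pseries_R. Qed.

Lemma Series_ge0 a : (forall n, 0 <= a n) -> ex_series a -> 0 <= Series a.
Proof.
  intros Ha Hex. transitivity (Series (fun n => 0 * a n)).
  - rewrite Series_scal_l. lra.
  - apply Series_le; [|exact Hex]. intros n. specialize (Ha n). lra.
Qed.

Lemma PSeries_ge0 a s : 0 <= s -> (forall n, 0 <= a n) -> ex_pseries a s -> 0 <= PSeries a s.
Proof.
  intros Hs Ha Hex. apply ex_pseries_R in Hex. apply Series_ge0; [|exact Hex].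
  intros n. apply Rmult_le_pos; [apply Ha|now apply pow_le].
Qed.

Lemma PSeries_le a b s : 0 <= s -> (forall n, a n <= b n) -> ex_pseries a s -> ex_pseries b s ->
  PSeries a s <= PSeries b s.
Proof.
  intros Hs Hab Ha Hb. assert (H : 0 <= PSeries (PS_minus b a) s).
  { apply PSeries_ge0; [exact Hs| |now apply @ex_pseries_minus].
    intros n. unfold PS_minus, plus, opp; simpl. specialize (Hab n). lra. }
  rewrite PSeries_minus in H by assumption. lra.
Qed.

(** * Moments *)

Definition sig2 (d : nat) (p : nat -> R) : R := / INR d * normsq d p.
(** The l1 norm has two uses: it bounds every jump, hence the overshoot below 0, and up to the
    factor [2d] it is exactly the mean overshoot of the first step. *)
Definition normp (d : nat) (p : nat -> R) : R := sumR d (fun i => Rabs (p i)).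

Definition kmom (d : nat) (p : nat -> R) (i n : nat) : R :=
  kill (stepR d p) ispos 0 n (fun y => y ^ i).
Definition emom (d : nat) (p : nat -> R) (i n : nat) : R :=
  exitc (stepR d p) ispos 0 n (fun y => y ^ i).

Lemma stepR_const d p c y : (1 <= d)%nat -> stepR d p (fun _ => c) y = c.
Proof.
  intros hd. unfold stepR. rewrite sumR_const. field. apply not_0_INR. lia.
Qed.

Lemma stepR_id d p y : (1 <= d)%nat -> stepR d p (fun y => y) y = y.
Proof.
  intros hd. unfold stepR. rewrite (sumR_ext d _ (fun _ => 2 * y)) by (intros; ring).
  rewrite sumR_const. field. apply not_0_INR. lia.
Qed.

Lemma stepR_sq d p y : (1 <= d)%nat -> stepR d p (fun y => y ^ 2) y = y ^ 2 + sig2 d p.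
Proof.
  intros hd. unfold stepR, sig2, normsq.
  rewrite (sumR_ext d _ (fun i => 2 * y ^ 2 + 2 * p i ^ 2)) by (intros; ring).
  rewrite sumR_plus, sumR_const, sumR_scal. field. apply not_0_INR. lia.
Qed.

(** This and the next two recursions are martingale identities: one step preserves the means of 1
    and [y], and adds [sig2] to that of [y^2]. *)
Lemma emom_0_S d p n : (1 <= d)%nat -> emom d p 0 (S n) = kmom d p 0 (S n) - kmom d p 0 n.
Proof.
  intros hd. unfold emom, kmom.
  assert (E : kill (stepR d p) ispos 0 n (fun y => y ^ 0)
     = kill (stepR d p) ispos 0 n (stepR d p (fun y => y ^ 0))).
  { f_equal. extensionality y. symmetry. now apply (stepR_const d p 1). }
  rewrite E, kill_step by apply stepR_linear. ring.
Qed.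

Lemma emom_1_S d p n : (1 <= d)%nat -> emom d p 1 (S n) = kmom d p 1 (S n) - kmom d p 1 n.
Proof.
  intros hd. unfold emom, kmom.
  replace (fun y : R => y ^ 1) with (fun y : R => y) by (extensionality y; ring).
  assert (E : kill (stepR d p) ispos 0 n (fun y => y)
     = kill (stepR d p) ispos 0 n (stepR d p (fun y => y))).
  { f_equal. extensionality y. symmetry. now apply stepR_id. }
  rewrite E, kill_step by apply stepR_linear. ring.
Qed.

Lemma emom_2_S d p n : (1 <= d)%nat ->
  emom d p 2 (S n) = kmom d p 2 (S n) - kmom d p 2 n - sig2 d p * kmom d p 0 n.
Proof.
  intros hd. unfold emom, kmom.
  assert (E : kill (stepR d p) ispos 0 n (stepR d p (fun y => y ^ 2))
     = kill (stepR d p) ispos 0 n (fun y => y ^ 2)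
       + sig2 d p * kill (stepR d p) ispos 0 n (fun y => y ^ 0)).
  { destruct (kill_linear (stepR d p) ispos 0 n (stepR_linear d p)) as [Ha Hs].
    rewrite <- Hs, <- Ha. f_equal. extensionality y. rewrite stepR_sq by exact hd. ring. }
  rewrite kill_step in E by apply stepR_linear. lra.
Qed.

Lemma ispos_ge0 y : 0 <= ispos y.
Proof. unfold ispos. destruct (Rlt_dec 0 y); lra. Qed.

Lemma kill_stepR_le d p n f g : (forall y, 0 <= y -> f y <= g y) ->
  kill (stepR d p) ispos 0 n f <= kill (stepR d p) ispos 0 n g.
Proof.
  intros H. apply (kill_le _ (fun _ => True)).
  - intros a b Hab x _. apply stepR_le. auto.
  - apply ispos_ge0.
  - exact I.
  - apply H. lra.
  - intros y _ Hy. apply H. unfold ispos in Hy. destruct (Rlt_dec 0 y); lra.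
Qed.

Lemma kill_stepR_0 d p n : kill (stepR d p) ispos 0 n (fun _ => 0) = 0.
Proof. apply (linear_fn_0 _ (kill_linear _ ispos 0 n (stepR_linear d p))). Qed.

Lemma kmom_ge0 d p i n : 0 <= kmom d p i n.
Proof.
  unfold kmom. apply Rle_trans with (1 := Req_le _ _ (eq_sym (kill_stepR_0 d p n))). apply kill_stepR_le. intros y Hy. now apply pow_le.
Qed.

Lemma Rabs_le_normp d p i : (i < d)%nat -> Rabs (p i) <= normp d p.
Proof. intros Hi. apply (sumR_ge_term d (fun i => Rabs (p i))); [exact Hi|intros; apply Rabs_pos]. Qed.

Lemma normp_ge0 d p : 0 <= normp d p.
Proof. apply sumR_ge0. intros. apply Rabs_pos. Qed.

(* From a nonnegative height, one step exits [ispos] into the window [-normp, 0]. *)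
Lemma stepR_exit_le d p f g y : 0 <= y ->
  (forall x, - normp d p <= x <= 0 -> f x <= g x) ->
  stepR d p (fun x => (1 - ispos x) * f x) y <= stepR d p (fun x => (1 - ispos x) * g x) y.
Proof.
  intros Hy H. unfold stepR. apply Rmult_le_compat_l; [apply inv_2d_ge0|].
  apply sumR_le. intros i Hi. pose proof (Rabs_le_normp d p i Hi) as Hp.
  apply Rabs_le_between in Hp.
  apply Rplus_le_compat; unfold ispos; match goal with |- context [Rlt_dec ?a ?b] =>
    destruct (Rlt_dec a b) end; try lra; rewrite Rminus_0_r, !Rmult_1_l; apply H; lra.
Qed.

Lemma exitc_le d p n f g : (forall x, - normp d p <= x <= 0 -> f x <= g x) ->
  exitc (stepR d p) ispos 0 (S n) g <= exitc (stepR d p) ispos 0 (S n) f.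
Proof.
  intros H. cbn [exitc]. apply Ropp_le_contravar. apply kill_stepR_le. intros y Hy.
  now apply stepR_exit_le.
Qed.

Lemma exitc_stepR_0 d p n : exitc (stepR d p) ispos 0 n (fun _ => 0) = 0.
Proof. apply (linear_fn_0 _ (exitc_linear _ ispos 0 n (stepR_linear d p))). Qed.

(** The signs of the moments at positive times follow from exit positions in [[-normp, 0]] and the
    minus sign in [exitc]. *)
Lemma emom_0_le0 d p n : emom d p 0 (S n) <= 0.
Proof.
  unfold emom. apply Rle_trans with (2 := Req_le _ _ (exitc_stepR_0 d p (S n))). apply exitc_le. intros. simpl. lra.
Qed.

Lemma emom_1_bounds d p n : 0 <= emom d p 1 (S n) <= normp d p * - emom d p 0 (S n).
Proof.
  unfold emom. split.
  - apply Rle_trans with (1 := Req_le _ _ (eq_sym (exitc_stepR_0 d p (S n)))).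
    apply exitc_le. intros. simpl. lra.
  - rewrite Ropp_mult_distr_r_reverse, Ropp_mult_distr_l.
    rewrite <- (proj2 (exitc_linear _ ispos 0 (S n) (stepR_linear d p))).
    apply exitc_le. intros. simpl. lra.
Qed.

Lemma emom_2_bounds d p n : normp d p ^ 2 * emom d p 0 (S n) <= emom d p 2 (S n) <= 0.
Proof.
  unfold emom. split.
  - rewrite <- (proj2 (exitc_linear _ ispos 0 (S n) (stepR_linear d p))).
    apply exitc_le. intros. simpl. nra.
  - apply Rle_trans with (2 := Req_le _ _ (exitc_stepR_0 d p (S n))).
    apply exitc_le. intros. simpl. nra.
Qed.

Lemma sig2_ge0 d p : 0 <= sig2 d p.
Proof.
  apply Rmult_le_pos.
  - pose proof (inv_2d_ge0 d). rewrite Rinv_mult in H. lra.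
  - apply sumR_ge0. intros. simpl. nra.
Qed.

Lemma kmom_0_le1 d p n : (1 <= d)%nat -> kmom d p 0 n <= 1.
Proof.
  intros hd. induction n as [|n IH]; [unfold kmom; simpl; lra|].
  pose proof (emom_0_S d p n hd). pose proof (emom_0_le0 d p n). lra.
Qed.

Lemma kmom_0_lin d p : (1 <= d)%nat -> lin_bounded (kmom d p 0).
Proof.
  intros hd. apply (bounded_lin _ 1). intros n. rewrite Rabs_pos_eq by apply kmom_ge0.
  now apply kmom_0_le1.
Qed.

Lemma kmom_1_lin d p : (1 <= d)%nat -> lin_bounded (kmom d p 1).
Proof.
  intros hd. exists (normp d p). intros n. rewrite Rabs_pos_eq by apply kmom_ge0.
  pose proof (normp_ge0 d p). induction n as [|n IH]; [unfold kmom; simpl; lra|].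
  pose proof (emom_1_S d p n hd). pose proof (emom_1_bounds d p n).
  pose proof (emom_0_S d p n hd). pose proof (kmom_0_le1 d p n hd).
  pose proof (kmom_ge0 d p 0 (S n)). rewrite S_INR.
  assert (normp d p * - emom d p 0 (S n) <= normp d p * 1) by (apply Rmult_le_compat_l; lra).
  lra.
Qed.

Lemma kmom_2_lin d p : (1 <= d)%nat -> lin_bounded (kmom d p 2).
Proof.
  intros hd. exists (sig2 d p). intros n. rewrite Rabs_pos_eq by apply kmom_ge0.
  pose proof (sig2_ge0 d p). induction n as [|n IH]; [unfold kmom; simpl; lra|].
  pose proof (emom_2_S d p n hd). pose proof (emom_2_bounds d p n).
  pose proof (kmom_0_le1 d p n hd). rewrite S_INR.
  assert (sig2 d p * kmom d p 0 n <= sig2 d p * 1) by (apply Rmult_le_compat_l; lra).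
  lra.
Qed.

Lemma exitc_neg d p n g :
  exitc (stepR d p) isneg 0 n g = exitc (stepR d p) ispos 0 n (fun y => g (- y)).
Proof.
  destruct n as [|n]; [cbn; now rewrite Ropp_0|].
  pose proof (kill_step (stepR d p) isneg 0 n g (stepR_linear d p)) as E1.
  pose proof (kill_step (stepR d p) ispos 0 n (fun y => g (- y)) (stepR_linear d p)) as E2.
  rewrite !kill_neg in E1.
  replace (fun y => stepR d p g (- y)) with (stepR d p (fun y => g (- y))) in E1
    by (extensionality y; symmetry; apply stepR_opp).
  lra.
Qed.

Lemma emom_0_0 d p : emom d p 0 0 = 1.
Proof. reflexivity. Qed.

Lemma emom_1_0 d p : emom d p 1 0 = 0.
Proof. unfold emom. simpl. ring. Qed.

Lemma emom_2_0 d p : emom d p 2 0 = 0.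
Proof. unfold emom. simpl. ring. Qed.

Lemma emom_0_gem1 d p n : (1 <= d)%nat -> -1 <= emom d p 0 (S n).
Proof.
  intros hd. rewrite emom_0_S by exact hd. pose proof (kmom_0_le1 d p n hd).
  pose proof (kmom_ge0 d p 0 (S n)). lra.
Qed.

Lemma emom_0_lin d p : (1 <= d)%nat -> lin_bounded (emom d p 0).
Proof.
  intros hd. apply (bounded_lin _ 1). intros [|n]; apply Rabs_le.
  - rewrite emom_0_0. lra.
  - pose proof (emom_0_gem1 d p n hd). pose proof (emom_0_le0 d p n). lra.
Qed.

Lemma emom_1_lin d p : (1 <= d)%nat -> lin_bounded (emom d p 1).
Proof.
  intros hd. apply (bounded_lin _ (normp d p)). pose proof (normp_ge0 d p).
  intros [|n]; apply Rabs_le.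
  - rewrite emom_1_0. lra.
  - pose proof (emom_0_gem1 d p n hd). pose proof (emom_1_bounds d p n).
    assert (normp d p * - emom d p 0 (S n) <= normp d p * 1) by (apply Rmult_le_compat_l; lra).
    lra.
Qed.

Lemma emom_2_lin d p : (1 <= d)%nat -> lin_bounded (emom d p 2).
Proof.
  intros hd. apply (bounded_lin _ (normp d p ^ 2)).
  assert (0 <= normp d p ^ 2) by apply pow2_ge_0.
  intros [|n]; apply Rabs_le.
  - rewrite emom_2_0. lra.
  - pose proof (emom_0_gem1 d p n hd). pose proof (emom_2_bounds d p n).
    assert (normp d p ^ 2 * -1 <= normp d p ^ 2 * emom d p 0 (S n))
      by (apply Rmult_le_compat_l; lra).
    lra.
Qed.

Lemma kmom_emom_kappa d p n : PS_mult (kmom d p 0) (emom d p 0) n = kappa d p n.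
Proof.
  rewrite <- (Rmult_1_r (kappa d p n)). rewrite <- (wiener_hopf_coeff d p n (fun _ => 1)).
  unfold PS_mult. rewrite <- sumR_f_R0. apply sumR_ext. intros m _.
  rewrite Rmult_comm. unfold kmom.
  rewrite <- (proj2 (kill_linear _ ispos 0 m (stepR_linear d p))). f_equal. extensionality x.
  rewrite exitc_neg. unfold emom. simpl. ring.
Qed.

(** The factorisation tested on [y^2]. Reflecting the exit law of the negative half-line turns
    [(x + y)^2] into [(x - y)^2], whence the sign of the cross term. *)
Lemma kmom_emom_2 d p n :
  PS_mult (kmom d p 2) (emom d p 0) n - 2 * PS_mult (kmom d p 1) (emom d p 1) n
  + PS_mult (kmom d p 0) (emom d p 2) n = 0.
Proof.
  transitivity (kappa d p n * 0 ^ 2); [|ring].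
  rewrite <- (wiener_hopf_coeff d p n (fun y => y ^ 2)).
  unfold PS_mult, Rminus. rewrite <- !sumR_f_R0, Ropp_mult_distr_l, <- sumR_scal, <- !sumR_plus.
  apply sumR_ext. intros m _.
  destruct (kill_linear _ ispos 0 m (stepR_linear d p)) as [Ha Hs].
  destruct (exitc_linear _ ispos 0 (n - m) (stepR_linear d p)) as [Va Vs].
  unfold kmom. rewrite (Rmult_comm (kill _ _ _ _ (fun y => y ^ 2))).
  rewrite (Rmult_comm (kill _ _ _ _ (fun y => y ^ 1))), <- Rmult_assoc.
  rewrite (Rmult_comm (kill _ _ _ _ (fun y => y ^ 0))).
  rewrite <- !Hs, <- !Ha. f_equal. extensionality x. unfold emom. rewrite exitc_neg.
  transitivity (x ^ 2 * exitc (stepR d p) ispos 0 (n - m) (fun y => y ^ 0)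
    + (-2 * x) * exitc (stepR d p) ispos 0 (n - m) (fun y => y ^ 1)
    + exitc (stepR d p) ispos 0 (n - m) (fun y => y ^ 2)); [ring|].
  rewrite <- !Vs, <- !Va. f_equal. extensionality y. ring.
Qed.

Lemma kappa_lin d p : (1 <= d)%nat -> lin_bounded (kappa d p).
Proof.
  intros hd. apply (bounded_lin _ 1). intros [|n].
  - rewrite kappa_0, Rabs_R1. lra.
  - assert (H1 : forall y, 0 <= ind0 y <= 1) by (intros y; unfold ind0; destruct (Req_EM_T y 0); lra).
    assert (H2 : emom d p 0 (S n) <= kappa d p (S n)).
    { unfold kappa, emom. rewrite exitc_neg. apply exitc_le. intros x _. simpl. apply H1. }
    assert (H3 : kappa d p (S n) <= 0).
    { apply Rle_trans with (2 := Req_le _ _ (exitc_stepR_0 d p (S n))).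
      unfold kappa. rewrite exitc_neg. apply exitc_le. intros x _. apply H1. }
    pose proof (emom_0_gem1 d p n hd). apply Rabs_le. lra.
Qed.

Lemma ret_bounds d p k y : (1 <= d)%nat -> 0 <= ret d p k y <= 1.
Proof.
  intros hd. revert y. induction k as [|k IH]; intros y.
  - change (ret d p 0 y) with (ind0 y). unfold ind0. destruct (Req_EM_T y 0); lra.
  - change (ret d p (S k) y) with (stepR d p (ret d p k) y). split.
    + apply Rle_trans with (1 := Req_le _ _ (eq_sym (stepR_const d p 0 y hd))).
      apply stepR_le. apply IH.
    + apply Rle_trans with (2 := Req_le _ _ (stepR_const d p 1 y hd)).
      apply stepR_le. apply IH.
Qed.

Definition spitzer (d : nat) (p : nat -> R) (s : R) : R :=
  Series (fun n => ret d p (S n) 0 / INR (S n) * s ^ S n).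

Lemma PSeries_kappa d p s : (1 <= d)%nat -> Rabs s < 1 ->
  PSeries (kappa d p) s = exp (- spitzer d p s).
Proof.
  intros hd Hs. apply (PSeries_exp (kappa d p) (fun n => ret d p (S n) 0)).
  - now apply kappa_lin.
  - apply (bounded_lin _ 1). intros n. pose proof (ret_bounds d p (S n) 0 hd).
    apply Rabs_le. lra.
  - apply kappa_0.
  - intros n. rewrite kappa_recursion. unfold PS_mult. rewrite <- sumR_f_R0. f_equal.
    apply sumR_ext. intros k Hk. do 2 f_equal. lia.
  - exact Hs.
Qed.

Lemma PSeries_emom d p s : (1 <= d)%nat -> Rabs s < 1 ->
  PSeries (emom d p 0) s = (1 - s) * PSeries (kmom d p 0) s /\
  PSeries (emom d p 1) s = (1 - s) * PSeries (kmom d p 1) s /\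
  PSeries (emom d p 2) s
    = (1 - s) * PSeries (kmom d p 2) s - sig2 d p * s * PSeries (kmom d p 0) s.
Proof.
  intros hd Hs.
  pose proof (lin_bounded_ex _ s (kmom_0_lin d p hd) Hs) as H0.
  pose proof (lin_bounded_ex _ s (kmom_1_lin d p hd) Hs) as H1.
  pose proof (lin_bounded_ex _ s (kmom_2_lin d p hd) Hs) as H2.
  assert (I : forall a : nat -> R, ex_pseries a s -> ex_pseries (PS_incr_1 a) s)
    by (intros; now apply ex_pseries_incr_1).
  repeat split.
  - rewrite (PSeries_ext _ (PS_minus (kmom d p 0) (PS_incr_1 (kmom d p 0)))).
    + rewrite PSeries_minus, PSeries_incr_1 by auto. ring.
    + intros [|n].
      * unfold PS_minus, PS_incr_1, plus, opp, kmom, emom, zero; simpl. ring.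
      * rewrite emom_0_S by exact hd. reflexivity.
  - rewrite (PSeries_ext _ (PS_minus (kmom d p 1) (PS_incr_1 (kmom d p 1)))).
    + rewrite PSeries_minus, PSeries_incr_1 by auto. ring.
    + intros [|n].
      * unfold PS_minus, PS_incr_1, plus, opp, kmom, emom, zero; simpl. ring.
      * rewrite emom_1_S by exact hd. reflexivity.
  - rewrite (PSeries_ext _ (PS_minus (PS_minus (kmom d p 2) (PS_incr_1 (kmom d p 2)))
      (PS_scal (sig2 d p) (PS_incr_1 (kmom d p 0))))).
    + rewrite !PSeries_minus, PSeries_scal, !PSeries_incr_1; auto.
      * ring.
      * apply @ex_pseries_minus; auto.
      * apply ex_pseries_scal; [apply Rmult_comm|]; auto.
    + intros [|n].
      * unfold PS_minus, PS_scal, PS_incr_1, plus, opp, scal, kmom, emom, zero; simpl.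
        unfold mult; simpl. ring.
      * rewrite emom_2_S by exact hd. reflexivity.
Qed.

Lemma stepR_exit_mean d p :
  - stepR d p (fun x => (1 - ispos x) * x ^ 1) 0 = normp d p / (2 * INR d).
Proof.
  unfold stepR, normp. unfold Rdiv. rewrite Rmult_comm, Ropp_mult_distr_l. f_equal.
  rewrite <- (Rmult_1_l (sumR d (fun i => Rabs (p i)))).
  replace (- sumR d (fun i => (1 - ispos (0 + p i)) * (0 + p i) ^ 1
      + (1 - ispos (0 - p i)) * (0 - p i) ^ 1))
    with (-1 * sumR d (fun i => (1 - ispos (0 + p i)) * (0 + p i) ^ 1
      + (1 - ispos (0 - p i)) * (0 - p i) ^ 1)) by ring.
  rewrite <- !sumR_scal. apply sumR_ext. intros i _.
  unfold ispos, Rabs. destruct (Rcase_abs (p i)), (Rlt_dec 0 (0 + p i)), (Rlt_dec 0 (0 - p i)); lra.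
Qed.

(** By [PSeries_emom], [b] and [w] are the mass and the first moment of [delta - W]. Testing on 1
    gives [b^2 = (1 - s) c]; testing on [y^2] gives an equality whose defect from [2 w^2] is [2 b]
    times the second moment of the exit law, at most [normp^2]. *)
Lemma generating_identities d p s : (1 <= d)%nat -> 0 < s < 1 ->
  let c := exp (- spitzer d p s) in
  let b := (1 - s) * PSeries (kmom d p 0) s in
  let w := (1 - s) * PSeries (kmom d p 1) s in
  0 <= b /\ b ^ 2 = (1 - s) * c /\ s * (normp d p / (2 * INR d)) <= w /\
  2 * w ^ 2 <= s * sig2 d p * c <= 2 * w ^ 2 + 2 * b * normp d p ^ 2.
Proof.
  intros hd Hs c b w. assert (Hs' : Rabs s < 1) by (apply Rabs_lt_between; lra).
  pose proof (kmom_0_lin d p hd) as K0. pose proof (kmom_1_lin d p hd) as K1.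
  pose proof (kmom_2_lin d p hd) as K2. pose proof (emom_0_lin d p hd) as V0.
  pose proof (emom_1_lin d p hd) as V1. pose proof (emom_2_lin d p hd) as V2.
  pose proof (fun a Ha => lin_bounded_ex a s Ha Hs') as Hex.
  pose proof (fun a Ha => lin_bounded_radius a s Ha Hs') as Hrad.
  destruct (PSeries_emom d p s hd Hs') as (E0 & E1 & E2). fold b in E0. fold w in E1.
  assert (Hb : 0 <= b).
  { apply Rmult_le_pos; [lra|]. apply PSeries_ge0; [lra| |now apply Hex].
    intros n. apply kmom_ge0. }
  assert (Ec : PSeries (kmom d p 0) s * b = c).
  { unfold c. rewrite <- PSeries_kappa by assumption. rewrite <- E0, <- PSeries_mult by auto.
    apply PSeries_ext. intros n. apply kmom_emom_kappa. }
  assert (E3 : PSeries (kmom d p 2) s * b - 2 * (PSeries (kmom d p 1) s * w)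
               + PSeries (kmom d p 0) s * PSeries (emom d p 2) s = 0).
  { rewrite <- E0, <- E1, <- !PSeries_mult by auto.
    pose proof (Hrad _ K0). pose proof (Hrad _ K1). pose proof (Hrad _ K2).
    assert (X : forall a b, lin_bounded a -> lin_bounded b -> ex_pseries (PS_mult a b) s).
    { intros a1 b1 Ha1 Hb1. eexists. apply is_pseries_mult; try apply PSeries_correct; auto. }
    rewrite <- PSeries_scal, <- PSeries_minus, <- PSeries_plus.
    - rewrite (PSeries_ext _ (fun _ => 0)).
      + apply PSeries_const_0.
      + intros n. apply kmom_emom_2.
    - apply @ex_pseries_minus; [auto|]. apply ex_pseries_scal; [apply Rmult_comm|]. auto.
    - auto.
    - auto.
    - apply ex_pseries_scal; [apply Rmult_comm|]. auto. }
  set (v2 := PSeries (emom d p 2) s) in *.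
  assert (Hv2 : - normp d p ^ 2 <= v2 <= 0).
  (* [delta] removes time 0, since [emom_2_bounds] compares the moments at positive times only. *)
  { set (delta := fun n => match n with O => 1 | S _ => 0 end : R).
    assert (Xd : lin_bounded delta).
    { apply (bounded_lin _ 1). intros [|n]; simpl; [rewrite Rabs_R1|rewrite Rabs_R0]; lra. }
    split.
    - apply Rle_trans with (normp d p ^ 2 * (b - 1)).
      { assert (0 <= normp d p ^ 2) by apply pow2_ge_0. nra. }
      replace (normp d p ^ 2 * (b - 1))
        with (PSeries (PS_scal (normp d p ^ 2) (PS_minus (emom d p 0) delta)) s).
      + apply PSeries_le; [lra| | |auto].
        * intros [|n].
          -- change (normp d p ^ 2 * (1 + - (1)) <= emom d p 2 0). rewrite emom_2_0. lra.
          -- change (normp d p ^ 2 * (emom d p 0 (S n) + - 0) <= emom d p 2 (S n)).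
             pose proof (emom_2_bounds d p n). lra.
        * apply ex_pseries_scal; [apply Rmult_comm|]. apply @ex_pseries_minus; auto.
      + rewrite PSeries_scal, PSeries_minus, E0 by auto. do 2 f_equal.
        rewrite PSeries_decr_1 by auto.
        rewrite (PSeries_ext (PS_decr_1 delta) (fun _ => 0)) by (intros [|n]; reflexivity).
        rewrite PSeries_const_0. simpl. ring.
    - rewrite <- (PSeries_const_0 s). apply PSeries_le; [lra| |auto|].
      + intros [|n]; [rewrite emom_2_0; lra|apply emom_2_bounds].
      + apply lin_bounded_ex; [|exact Hs']. apply (bounded_lin _ 0). intros _. rewrite Rabs_R0. lra. }
  (* Only exits at time 1 are kept; the later coefficients of the first moment are nonnegative. *)
  assert (Hw : s * (normp d p / (2 * INR d)) <= w).
  { rewrite <- E1. rewrite PSeries_decr_1 by auto. rewrite emom_1_0, Rplus_0_l.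
    apply Rmult_le_compat_l; [lra|].
    assert (X1 : ex_pseries (PS_decr_1 (emom d p 1)) s).
    { apply ex_pseries_decr_1; [right; exists (/ s); apply Rinv_l; lra|auto]. }
    rewrite PSeries_decr_1 by exact X1. unfold PS_decr_1 at 1.
    assert (X2 : 0 <= PSeries (PS_decr_1 (PS_decr_1 (emom d p 1))) s).
    { apply PSeries_ge0; [lra| |].
      - intros n. apply emom_1_bounds.
      - apply ex_pseries_decr_1; [right; exists (/ s); apply Rinv_l; lra|auto]. }
    rewrite <- stepR_exit_mean. change (emom d p 1 1)
      with (- stepR d p (fun x => (1 - ispos x) * x ^ 1) 0). nra. }
  set (a0 := PSeries (kmom d p 0) s) in *. set (a1 := PSeries (kmom d p 1) s) in *.
  set (a2 := PSeries (kmom d p 2) s) in *.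
  assert (Hb2 : b ^ 2 = (1 - s) * c) by (rewrite <- Ec; unfold b; ring).
  (* Multiply [E3] by [1 - s], eliminate [(1 - s) * a2] by [E2], and use [a0 * b = c]. *)
  assert (Key : s * sig2 d p * c = 2 * w ^ 2 - 2 * b * v2).
  { assert (F : (1 - s) * a2 = v2 + sig2 d p * s * a0) by lra.
    assert (G : ((1 - s) * a2) * b - 2 * w ^ 2 + b * v2 = 0).
    { transitivity ((1 - s) * (a2 * b - 2 * (a1 * w) + a0 * v2)).
      - unfold w. unfold b at 2. ring.
      - rewrite E3. ring. }
    rewrite F in G. rewrite <- Ec. nra. }
  repeat split; auto; rewrite Key; nra.
Qed.

(** * Limits *)

Lemma Series_tail_le a M N : (forall n, Rabs (a n) <= M n) -> ex_series M ->
  Rabs (Series a - sum_f_R0 a N) <= Series M - sum_f_R0 M N.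
Proof.
  intros H HM.
  assert (Ha : ex_series a) by (apply (ex_series_le a M); assumption).
  rewrite (Series_incr_n a (S N)), (Series_incr_n M (S N)) by (auto; lia). cbn [pred].
  replace (sum_f_R0 a N + Series (fun k => a (S N + k)%nat) - sum_f_R0 a N)
    with (Series (fun k => a (S N + k)%nat)) by ring.
  replace (sum_f_R0 M N + Series (fun k => M (S N + k)%nat) - sum_f_R0 M N)
    with (Series (fun k => M (S N + k)%nat)) by ring.
  assert (HM' : ex_series (fun k => M (S N + k)%nat)) by now apply (ex_series_incr_n M (S N)).
  eapply Rle_trans; [apply Series_Rabs|apply Series_le; [|exact HM']].
  - apply (@ex_series_le R_AbsRing R_CompleteNormedModule _ (fun k => M (S N + k)%nat)); [|exact HM'].
    intros n. unfold norm; simpl. unfold abs; simpl. rewrite Rabs_Rabsolu. apply H.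
  - intros n. split; [apply Rabs_pos|apply H].
Qed.

Lemma partial_sum_cv a : ex_series a -> is_lim_seq (sum_f_R0 a) (Series a).
Proof. intros H. apply is_lim_seq_Reals. apply is_series_Reals. now apply Series_correct. Qed.

Lemma tannery (f : nat -> nat -> R) (g M : nat -> R) : ex_series M ->
  (forall m n, Rabs (f m n) <= M n) -> (forall n, is_lim_seq (fun m => f m n) (g n)) ->
  is_lim_seq (fun m => Series (f m)) (Series g).
Proof.
  intros HM Hf Hlim.
  assert (Hg : forall n, Rabs (g n) <= M n).
  { intros n. apply (is_lim_seq_le (fun m => Rabs (f m n)) (fun _ => M n) (Rabs (g n)) (M n)).
    - intros; apply Hf.
    - apply (is_lim_seq_abs _ (g n)), Hlim.
    - apply is_lim_seq_const. }
  apply is_lim_seq_spec. intros eps. pose proof (cond_pos eps) as He.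
  destruct (proj2 (is_lim_seq_spec _ _) (partial_sum_cv M HM) (mkposreal (eps / 4) ltac:(lra)))
    as [N HN]. specialize (HN N (le_n N)). simpl in HN. apply Rabs_lt_between in HN.
  assert (Hfin : is_lim_seq (fun m => sum_f_R0 (f m) N) (sum_f_R0 g N)).
  { clear HN. induction N as [|N IH]; [apply Hlim|]. simpl. now apply is_lim_seq_plus'. }
  destruct (proj2 (is_lim_seq_spec _ _) Hfin (mkposreal (eps / 4) ltac:(lra))) as [m0 Hm0].
  exists m0. intros m Hm. specialize (Hm0 m Hm). simpl in Hm0. apply Rabs_lt_between in Hm0.
  pose proof (Series_tail_le (f m) M N (Hf m) HM) as H1.
  pose proof (Series_tail_le g M N Hg HM) as H2.
  apply Rabs_le_between in H1. apply Rabs_le_between in H2. apply Rabs_lt_between. lra.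
Qed.

Lemma ex_series_bounded a B : (forall n, 0 <= a n) -> (forall n, sum_f_R0 a n <= B) -> ex_series a.
Proof.
  intros Ha HB. destruct (ex_finite_lim_seq_incr (sum_f_R0 a) B) as [l Hl].
  - intros n. simpl. specialize (Ha (S n)). lra.
  - exact HB.
  - exists l. apply is_series_Reals. now apply is_lim_seq_Reals.
Qed.

Lemma sum_le_Series a N : (forall n, 0 <= a n) -> ex_series a -> sum_f_R0 a N <= Series a.
Proof.
  intros Ha Hex. rewrite (Series_incr_n a (S N)) by (auto; lia). cbn [pred].
  assert (0 <= Series (fun k => a (S N + k)%nat)); [|lra].
  apply Series_ge0; [intros; apply Ha|]. now apply (ex_series_incr_n a (S N)).
Qed.

(** The truncation levels of [is_Fourier]. The same sequence serves as [1 - s] when [s -> 1], so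
    that both limits run along one index. *)
Definition eps_seq (m : nat) : R := / INR (m + 2).

Lemma eps_seq_bounds m : 0 < eps_seq m <= 1 / 2.
Proof.
  unfold eps_seq. rewrite plus_INR. simpl. pose proof (pos_INR m). split.
  - apply Rinv_0_lt_compat. lra.
  - unfold Rdiv. rewrite Rmult_1_l. apply Rinv_le_contravar; lra.
Qed.

Lemma eps_seq_lim : is_lim_seq eps_seq 0.
Proof.
  apply (is_lim_seq_incr_n (fun n => / INR n) 2 0).
  replace (Finite 0) with (Rbar_inv p_infty) by reflexivity.
  apply is_lim_seq_inv; [apply is_lim_seq_INR|discriminate].
Qed.

Lemma one_minus_eps_lim : is_lim_seq (fun m => 1 - eps_seq m) 1.
Proof.
  replace (Finite 1) with (Finite (1 - 0)) by (f_equal; ring).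
  apply is_lim_seq_minus'; [apply is_lim_seq_const|apply eps_seq_lim].
Qed.

Lemma one_minus_eps_pow_lim n : is_lim_seq (fun m => (1 - eps_seq m) ^ n) 1.
Proof.
  induction n as [|n IH]; [apply is_lim_seq_const|]. cbn [pow].
  replace (Finite 1) with (Finite (1 * 1)) by (f_equal; ring).
  apply is_lim_seq_mult'; [apply one_minus_eps_lim|exact IH].
Qed.

Lemma one_minus_eps_pow_bounds m n : 0 <= (1 - eps_seq m) ^ n <= 1.
Proof.
  pose proof (eps_seq_bounds m). split; [apply pow_le; lra|].
  apply Rle_trans with (1 ^ n); [apply pow_incr; lra|rewrite pow1; lra].
Qed.

Definition retlog (d : nat) (p : nat -> R) (n : nat) : R := ret d p (S n) 0 / INR (S n).

Lemma retlog_bounds d p n : (1 <= d)%nat -> 0 <= retlog d p n <= 1.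
Proof.
  intros hd. unfold retlog. pose proof (ret_bounds d p (S n) 0 hd) as H.
  assert (H1 : 1 <= INR (S n)) by (rewrite S_INR; pose proof (pos_INR n); lra).
  assert (H2 : 0 < / INR (S n) <= 1).
  { split; [apply Rinv_0_lt_compat; lra|]. rewrite <- Rinv_1. apply Rinv_le_contravar; lra. }
  unfold Rdiv. nra.
Qed.

Lemma spitzer_ex d p s : (1 <= d)%nat -> 0 < s < 1 -> ex_series (fun n => retlog d p n * s ^ S n).
Proof.
  intros hd Hs. assert (Hs' : Rabs s < 1) by (apply Rabs_lt_between; lra).
  assert (H : lin_bounded (retlog d p)).
  { apply (bounded_lin _ 1). intros n. pose proof (retlog_bounds d p n hd). apply Rabs_le. lra. }
  apply (lin_bounded_ex _ s) in H; [|exact Hs']. apply ex_pseries_R in H.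
  apply (ex_series_ext (fun n => s * (retlog d p n * s ^ n))); [intros; simpl; ring|].
  now apply (ex_series_scal_l s (fun n => retlog d p n * s ^ n)).
Qed.

Lemma spitzer_ge0 d p s : (1 <= d)%nat -> 0 < s < 1 -> 0 <= spitzer d p s.
Proof.
  intros hd Hs. apply Series_ge0; [|now apply spitzer_ex].
  intros n. apply Rmult_le_pos; [now apply retlog_bounds|]. apply pow_le; lra.
Qed.

Lemma normsq_pos d p : (exists i, (i < d)%nat /\ p i <> 0) -> 0 < normsq d p.
Proof.
  intros (i & Hi & Hp). apply Rlt_le_trans with (p i ^ 2).
  - simpl. nra.
  - apply (sumR_ge_term d (fun i => p i ^ 2)); [exact Hi|]. intros. apply pow2_ge_0.
Qed.

Lemma normp_pos d p : (exists i, (i < d)%nat /\ p i <> 0) -> 0 < normp d p.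
Proof.
  intros (i & Hi & Hp). apply Rlt_le_trans with (Rabs (p i)).
  - now apply Rabs_pos_lt.
  - now apply Rabs_le_normp.
Qed.

Lemma sig2_pos d p : (1 <= d)%nat -> (exists i, (i < d)%nat /\ p i <> 0) -> 0 < sig2 d p.
Proof.
  intros hd hp. apply Rmult_lt_0_compat; [|now apply normsq_pos].
  apply Rinv_0_lt_compat, lt_0_INR. lia.
Qed.

(** The lower bound on [w] keeps [c(s) = exp (- spitzer)] away from 0 uniformly in [s], so every
    partial sum of the nonnegative terms is bounded. *)
Lemma retlog_summable d p : (1 <= d)%nat -> (exists i, (i < d)%nat /\ p i <> 0) ->
  ex_series (retlog d p).
Proof.
  intros hd hp.
  set (k0 := normp d p / (2 * INR d)).
  pose proof (normp_pos d p hp) as Hn. pose proof (sig2_pos d p hd hp) as Hsig.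
  assert (HD : 0 < INR d) by (apply lt_0_INR; lia).
  assert (Hk : 0 < k0) by (apply Rdiv_lt_0_compat; lra).
  (* From [2 w^2 <= s * sig2 * c] and [w >= s * k0] one gets [c >= 2 * s * k0^2 / sig2], which is at
     least [c0] once [s >= 1/2]. *)
  set (c0 := k0 ^ 2 / sig2 d p).
  assert (Hc0 : 0 < c0) by (apply Rdiv_lt_0_compat; [apply pow_lt; lra|lra]).
  apply (ex_series_bounded _ (- ln c0)); [intros; now apply retlog_bounds|].
  intros N.
  apply (is_lim_seq_le (fun m => sum_f_R0 (fun n => retlog d p n * (1 - eps_seq m) ^ S n) N)
          (fun _ => - ln c0) (sum_f_R0 (retlog d p) N) (- ln c0)).
  - intros m. pose proof (eps_seq_bounds m) as He. set (s := 1 - eps_seq m).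
    assert (Hs : 0 < s < 1) by (unfold s; lra).
    apply Rle_trans with (spitzer d p s).
    + apply (sum_le_Series (fun n => retlog d p n * s ^ S n)); [|now apply spitzer_ex].
      intros n. apply Rmult_le_pos; [now apply retlog_bounds|]. apply pow_le; lra.
    + destruct (generating_identities d p s hd Hs) as (_ & _ & Hw & Hc & _).
      fold k0 in Hw. set (w := (1 - s) * PSeries (kmom d p 1) s) in *.
      assert (c0 <= exp (- spitzer d p s)).
      { unfold c0. apply Rmult_le_reg_r with (sig2 d p); [lra|].
        unfold Rdiv. rewrite Rmult_assoc, Rinv_l, Rmult_1_r by lra.
        assert (Hs2 : 1 / 2 <= s) by (unfold s; lra).
        assert ((s * k0) ^ 2 <= w ^ 2) by (apply pow_incr; split; [|exact Hw]; apply Rmult_le_pos; lra).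
        assert (H3 : 2 * s * k0 ^ 2 * s <= s * (exp (- spitzer d p s) * sig2 d p)) by nra.
        assert (H4 : 2 * s * k0 ^ 2 <= exp (- spitzer d p s) * sig2 d p).
        { apply Rmult_le_reg_r with s; lra. }
        assert (0 < k0 ^ 2) by (apply pow_lt; lra). nra. }
      assert (ln c0 <= - spitzer d p s).
      { rewrite <- (ln_exp (- spitzer d p s)). now apply Rcomplements.ln_le. }
      lra.
  - induction N as [|N IH]; cbn [sum_f_R0]; [|apply is_lim_seq_plus'; [exact IH|]];
      (rewrite <- (Rmult_1_r (retlog d p _)) at 1;
       apply is_lim_seq_mult'; [apply is_lim_seq_const|apply one_minus_eps_pow_lim]).
  - apply is_lim_seq_const.
Qed.

Lemma spitzer_lim d p : (1 <= d)%nat -> (exists i, (i < d)%nat /\ p i <> 0) ->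
  is_lim_seq (fun m => spitzer d p (1 - eps_seq m)) (Series (retlog d p)).
Proof.
  intros hd hp. apply (tannery _ _ (retlog d p)); [now apply retlog_summable| |].
  - intros m n. change (Rabs (retlog d p n * (1 - eps_seq m) ^ S n) <= retlog d p n).
    pose proof (retlog_bounds d p n hd) as H1.
    pose proof (one_minus_eps_pow_bounds m (S n)) as H2.
    rewrite Rabs_pos_eq by (apply Rmult_le_pos; lra).
    rewrite <- (Rmult_1_r (retlog d p n)) at 2. apply Rmult_le_compat_l; lra.
  - intros n. replace (Finite (retlog d p n)) with (Finite (retlog d p n * 1)) by (f_equal; ring).
    apply is_lim_seq_mult'; [apply is_lim_seq_const|apply one_minus_eps_pow_lim].
Qed.

Definition wgen (d : nat) (p : nat -> R) (m : nat) : R :=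
  eps_seq m * PSeries (kmom d p 1) (1 - eps_seq m).
Definition bgen (d : nat) (p : nat -> R) (m : nat) : R :=
  eps_seq m * PSeries (kmom d p 0) (1 - eps_seq m).

Lemma bgen_lim d p : (1 <= d)%nat -> is_lim_seq (bgen d p) 0.
Proof.
  intros hd.
  assert (H : forall m, 0 <= bgen d p m /\ bgen d p m ^ 2 <= eps_seq m).
  { intros m. pose proof (eps_seq_bounds m) as He. set (s := 1 - eps_seq m).
    assert (Hs : 0 < s < 1) by (unfold s; lra).
    destruct (generating_identities d p s hd Hs) as (H1 & H2 & _).
    unfold s in H1, H2. replace (1 - (1 - eps_seq m)) with (eps_seq m) in H1, H2 by ring.
    split; [exact H1|]. unfold bgen. rewrite H2.
    assert (exp (- spitzer d p (1 - eps_seq m)) <= 1).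
    { apply Rle_trans with (exp 0); [|rewrite exp_0; lra].
      pose proof (spitzer_ge0 d p s hd Hs) as Hg. fold s.
      destruct Hg as [Hg|Hg]; [left; apply exp_increasing; lra|rewrite <- Hg, Ropp_0; lra]. }
    pose proof (exp_pos (- spitzer d p (1 - eps_seq m))). nra. }
  apply is_lim_seq_spec. intros eps. pose proof (cond_pos eps) as He.
  destruct (proj2 (is_lim_seq_spec _ _) eps_seq_lim
    (mkposreal (eps ^ 2) ltac:(apply pow_lt; lra))) as [N HN].
  exists N. intros m Hm. specialize (HN m Hm). simpl in HN. destruct (H m) as [H1 H2].
  pose proof (eps_seq_bounds m). rewrite Rminus_0_r in *. rewrite Rabs_pos_eq in HN by lra.
  rewrite Rabs_pos_eq by lra. apply Rnot_le_lt. intros Hc.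
  assert (eps ^ 2 <= bgen d p m ^ 2) by (apply pow_incr; lra). simpl in *. lra.
Qed.

Lemma wgen_sq_lim d p : (1 <= d)%nat -> (exists i, (i < d)%nat /\ p i <> 0) ->
  is_lim_seq (fun m => wgen d p m ^ 2) (sig2 d p / 2 * exp (- Series (retlog d p))).
Proof.
  intros hd hp.
  set (q := fun m => (1 - eps_seq m) * sig2 d p * exp (- spitzer d p (1 - eps_seq m))).
  assert (Hq : is_lim_seq q (sig2 d p * exp (- Series (retlog d p)))).
  { replace (Finite (sig2 d p * exp (- Series (retlog d p))))
      with (Finite (1 * sig2 d p * exp (- Series (retlog d p)))) by (f_equal; ring).
    apply is_lim_seq_mult'.
    - apply is_lim_seq_mult'; [apply one_minus_eps_lim|apply is_lim_seq_const].
    - apply (is_lim_seq_continuous (fun x => exp (- x))).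
      + apply derivable_continuous_pt. apply ex_derive_Reals_0. auto_derive. exact I.
      + now apply spitzer_lim. }
  apply (is_lim_seq_le_le (fun m => / 2 * q m - normp d p ^ 2 * bgen d p m) _ (fun m => / 2 * q m)).
  - intros m. pose proof (eps_seq_bounds m) as He.
    assert (Hs : 0 < 1 - eps_seq m < 1) by lra.
    destruct (generating_identities d p (1 - eps_seq m) hd Hs) as (_ & _ & _ & H1 & H2).
    replace (1 - (1 - eps_seq m)) with (eps_seq m) in H1, H2 by ring.
    fold (wgen d p m) in H1, H2. fold (bgen d p m) in H2. fold (q m) in H1, H2. lra.
  - replace (sig2 d p / 2 * exp (- Series (retlog d p)))
      with (/ 2 * (sig2 d p * exp (- Series (retlog d p))) - normp d p ^ 2 * 0) by field.
    apply is_lim_seq_minus'; apply is_lim_seq_mult'; try apply is_lim_seq_const; auto.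
    now apply bgen_lim.
  - replace (sig2 d p / 2 * exp (- Series (retlog d p)))
      with (/ 2 * (sig2 d p * exp (- Series (retlog d p)))) by field.
    apply is_lim_seq_mult'; [apply is_lim_seq_const|exact Hq].
Qed.

(** * The walk on the lattice *)

Definition stepZ (d : nat) (f : (nat -> Z) -> R) (x : nat -> Z) : R :=
  / (2 * INR d) * sumR d (fun i => f (shift x i 1) + f (shift x i (-1))).

Lemma stepZ_linear d : linear_op (stepZ d).
Proof.
  intros y. unfold stepZ. split; intros.
  - rewrite <- Rmult_plus_distr_l, <- sumR_plus. f_equal. apply sumR_ext. intros. ring.
  - rewrite (sumR_ext d _ (fun i => c * (f (shift y i 1) + f (shift y i (-1))))) by (intros; ring).
    rewrite sumR_scal. ring.
Qed.

Lemma stepZ_commutes d : op_commutes (stepZ d).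
Proof.
  intros T L F y HL. unfold stepZ. rewrite (proj2 HL). f_equal.
  rewrite (linear_fn_sumR L d (fun i t => F (shift y i 1) t + F (shift y i (-1)) t) HL).
  apply sumR_ext. intros. symmetry. apply (proj1 HL).
Qed.

Lemma inZd_shift d x i s : (i < d)%nat -> inZd d x -> inZd d (shift x i s).
Proof.
  intros Hi Hx j Hj. unfold shift. destruct (Nat.eqb_spec j i); [lia|now apply Hx].
Qed.

Lemma inZd_zeroZ d : inZd d zeroZ.
Proof. now intros i _. Qed.

Lemma stepZ_monotone d : monotone_on (inZd d) (stepZ d).
Proof.
  intros f g H x Hx. unfold stepZ. apply Rmult_le_compat_l; [apply inv_2d_ge0|].
  apply sumR_le. intros i Hi. apply Rplus_le_compat; apply H; now apply inZd_shift.
Qed.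

Lemma dotRZ_shift d p x i s : (i < d)%nat -> dotRZ d p (shift x i s) = dotRZ d p x + p i * IZR s.
Proof.
  intros Hi. unfold dotRZ.
  pose proof (sumR_single d (fun j => if Nat.eqb j i then p j * IZR s else 0) i Hi) as E.
  cbn beta in E. rewrite Nat.eqb_refl in E. rewrite <- E.
  - rewrite <- sumR_plus. apply sumR_ext. intros j _. unfold shift.
    destruct (Nat.eqb j i); [rewrite plus_IZR; ring|ring].
  - intros j _ Hj. now apply Nat.eqb_neq in Hj as ->.
Qed.

Lemma dotRZ_zeroZ d p : dotRZ d p zeroZ = 0.
Proof. apply sumR_0. intros. unfold zeroZ. ring. Qed.

Lemma stepZ_dotRZ d p g x :
  stepZ d (fun x => g (dotRZ d p x)) x = stepR d p g (dotRZ d p x).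
Proof.
  unfold stepZ, stepR. f_equal. apply sumR_ext. intros i Hi.
  rewrite !dotRZ_shift by exact Hi. f_equal; f_equal; ring.
Qed.

(** Killing depends on [p.x] only, and functions of [p.x] are stable under the lattice step. *)
Lemma kill_dotRZ d p n g :
  kill (stepZ d) (fun x => ispos (dotRZ d p x)) zeroZ n (fun x => g (dotRZ d p x))
  = kill (stepR d p) ispos 0 n g.
Proof.
  revert g. induction n as [|n IH]; intros g; cbn [kill]; [now rewrite dotRZ_zeroZ|].
  rewrite <- IH. f_equal. extensionality x.
  apply (stepZ_dotRZ d p (fun y => ispos y * g y)).
Qed.

Lemma stepZ_lap d u x : (1 <= d)%nat -> stepZ d u x = u x + lap d u x / (2 * INR d).
Proof.
  intros hd. unfold stepZ, lap.
  rewrite (sumR_ext d (fun i => u (shift x i 1) + u (shift x i (-1)) - 2 * u x)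
    (fun i => u (shift x i 1) + u (shift x i (-1)) + - (2 * u x))) by (intros; ring).
  rewrite (sumR_plus d (fun i => u (shift x i 1) + u (shift x i (-1)))), sumR_const. field.
  apply not_0_INR. lia.
Qed.

Lemma kill_S_eq_on {X} (P : (X -> R) -> X -> R) (D : X -> Prop) chi x0 n f g :
  monotone_on D P -> (forall x, 0 <= chi x) -> D x0 ->
  (forall x, D x -> 0 < chi x -> f x = g x) ->
  kill P chi x0 (S n) f = kill P chi x0 (S n) g.
Proof.
  intros HP Hc HD H. apply Rle_antisym; apply (kill_S_le P D); auto;
    intros x Hx Hx'; rewrite H; auto; apply Rle_refl.
Qed.

(* Optional stopping: the harmonic function [u] is preserved by the killed walk. *)
Lemma kill_solution d p u n : (1 <= d)%nat -> is_sol d p u ->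
  kill (stepZ d) (fun x => ispos (dotRZ d p x)) zeroZ (S n) u = lap d u zeroZ / (2 * INR d).
Proof.
  intros hd (Hharm & Hzero & _).
  assert (Hpos : forall x, 0 < ispos (dotRZ d p x) -> 0 < dotRZ d p x).
  { intros x Hx. apply ispos_neq0. lra. }
  assert (Hu : forall x, inZd d x -> ispos (dotRZ d p x) * u x = u x).
  { intros x Hx. unfold ispos. destruct (Rlt_dec 0 (dotRZ d p x)); [ring|].
    rewrite Hzero by (auto; lra). ring. }
  assert (Hstep : forall x, inZd d x ->
    stepZ d (fun x => ispos (dotRZ d p x) * u x) x = stepZ d u x).
  { intros x Hx. apply Rle_antisym; apply stepZ_monotone; auto; intros y Hy; rewrite Hu by auto;
      apply Rle_refl. }
  induction n as [|n IH].
  (* The first step leaves 0, where [u] vanishes without being harmonic; this is where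
     [lap d u zeroZ] enters. Later steps leave points with [p.x > 0]. *)
  - cbn [kill]. rewrite Hstep, stepZ_lap by (auto using inZd_zeroZ).
    rewrite (Hzero zeroZ) by (auto using inZd_zeroZ; rewrite dotRZ_zeroZ; lra). ring.
  - rewrite <- IH. rewrite <- (kill_S_eq_on (stepZ d) (inZd d) _ zeroZ n
      (stepZ d (fun x => ispos (dotRZ d p x) * u x)) u).
    + reflexivity.
    + apply stepZ_monotone.
    + intros. apply ispos_ge0.
    + apply inZd_zeroZ.
    + intros x Hx Hx'. rewrite Hstep, stepZ_lap by auto.
      rewrite Hharm by (auto; apply Hpos; auto). unfold Rdiv. ring.
Qed.

(** On the half-space [u] is within a constant of [p.x], so the conserved mean of [u] is the first
    moment of the killed walk up to a multiple of its survival probability. *)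
Lemma solution_kmom d p u : (1 <= d)%nat -> is_sol d p u -> exists C, 0 <= C /\
  forall n, Rabs (lap d u zeroZ / (2 * INR d) - kmom d p 1 (S n)) <= C * kmom d p 0 (S n).
Proof.
  intros hd Hsol. pose proof Hsol as (_ & _ & C & HC). exists (Rabs C).
  split; [apply Rabs_pos|]. intros n. rewrite <- (kill_solution d p u n hd Hsol).
  unfold kmom. rewrite <- !(kill_dotRZ d p (S n)).
  set (chi := fun x => ispos (dotRZ d p x)).
  destruct (kill_linear (stepZ d) chi zeroZ (S n) (stepZ_linear d)) as [Ka Ks].
  rewrite <- (linear_fn_sub _ _ _ (kill_linear (stepZ d) chi zeroZ (S n) (stepZ_linear d))).
  rewrite <- Ks. apply Rabs_le. replace (- kill (stepZ d) chi zeroZ (S n)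
    (fun x => Rabs C * dotRZ d p x ^ 0)) with (kill (stepZ d) chi zeroZ (S n)
    (fun x => -1 * (Rabs C * dotRZ d p x ^ 0))) by (rewrite Ks; ring).
  assert (B : forall x, inZd d x -> 0 < chi x -> - Rabs C <= u x - dotRZ d p x ^ 1 <= Rabs C).
  { intros x Hx Hx'. assert (H0 : dotRZ d p x > 0) by (apply ispos_neq0; unfold chi in Hx'; lra).
    specialize (HC x Hx H0). apply Rabs_le_between. rewrite pow_1.
    eapply Rle_trans; [exact HC|apply Rle_abs]. }
  split; apply (kill_S_le (stepZ d) (inZd d));
    try apply stepZ_monotone; try apply inZd_zeroZ; try (intros; apply ispos_ge0);
    intros x Hx Hx'; specialize (B x Hx Hx'); rewrite pow_O; lra.
Qed.

(** Summing [solution_kmom] against [(1 - s) s^n] gives [w = h * s] up to [C * b], where [h] is the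
    claimed limit, and [b] tends to 0. *)
Lemma wgen_lim d p u : (1 <= d)%nat -> is_sol d p u ->
  is_lim_seq (wgen d p) (lap d u zeroZ / (2 * INR d)).
Proof.
  intros hd Hsol. destruct (solution_kmom d p u hd Hsol) as (C & HC & H).
  set (h := lap d u zeroZ / (2 * INR d)) in *.
  assert (B : forall m, h * (1 - eps_seq m) - C * bgen d p m <= wgen d p m
                        <= h * (1 - eps_seq m) + C * bgen d p m).
  { intros m. pose proof (eps_seq_bounds m) as He. set (s := 1 - eps_seq m).
    assert (Hs : 0 < s < 1) by (unfold s; lra).
    assert (Hs' : Rabs s < 1) by (apply Rabs_lt_between; lra).
    set (q := PS_scal h (PS_incr_1 (fun _ => 1))).
    assert (E1 : ex_pseries (fun _ => 1) s).
    { apply lin_bounded_ex; [|exact Hs']. apply (bounded_lin _ 1). intros. rewrite Rabs_R1. lra. }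
    assert (Eq : ex_pseries q s).
    { apply ex_pseries_scal; [apply Rmult_comm|]. now apply ex_pseries_incr_1. }
    pose proof (lin_bounded_ex _ s (kmom_0_lin d p hd) Hs') as X0.
    pose proof (lin_bounded_ex _ s (kmom_1_lin d p hd) Hs') as X1.
    assert (Xc : ex_pseries (PS_scal C (kmom d p 0)) s)
      by (apply ex_pseries_scal; [apply Rmult_comm|]; auto).
    assert (Vq : eps_seq m * PSeries q s = h * s).
    { unfold q. rewrite PSeries_scal, PSeries_incr_1. unfold PSeries.
      rewrite (Series_ext _ (fun n => s ^ n)) by (intros; ring).
      rewrite Series_geom by exact Hs'. unfold s. field. lra. }
    assert (L1 : PSeries (PS_minus q (PS_scal C (kmom d p 0))) s <= PSeries (kmom d p 1) s).
    { apply PSeries_le; [lra| |now apply @ex_pseries_minus|exact X1]. intros [|n].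
      - change (h * 0 + - (C * 1) <= 0 ^ 1). lra.
      - change (h * 1 + - (C * kmom d p 0 (S n)) <= kmom d p 1 (S n)).
        specialize (H n). apply Rabs_le_between in H. lra. }
    assert (L2 : PSeries (kmom d p 1) s <= PSeries (PS_plus q (PS_scal C (kmom d p 0))) s).
    { apply PSeries_le; [lra| |exact X1|now apply @ex_pseries_plus]. intros [|n].
      - change (0 ^ 1 <= h * 0 + C * 1). lra.
      - change (kmom d p 1 (S n) <= h * 1 + C * kmom d p 0 (S n)).
        specialize (H n). apply Rabs_le_between in H. lra. }
    rewrite PSeries_minus, PSeries_scal in L1 by auto.
    rewrite PSeries_plus, PSeries_scal in L2 by auto.
    unfold wgen, bgen. fold s. rewrite <- Vq. split; nra. }
  apply (is_lim_seq_le_le _ _ _ _ B).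
  - replace (Finite h) with (Finite (h * 1 - C * 0)) by (f_equal; ring).
    apply is_lim_seq_minus'; apply is_lim_seq_mult';
      auto using is_lim_seq_const, one_minus_eps_lim, bgen_lim.
  - replace (Finite h) with (Finite (h * 1 + C * 0)) by (f_equal; ring).
    apply is_lim_seq_plus'; apply is_lim_seq_mult';
      auto using is_lim_seq_const, one_minus_eps_lim, bgen_lim.
Qed.

Lemma hamiltonian_sq d p u : (1 <= d)%nat -> (exists i, (i < d)%nat /\ p i <> 0) -> is_sol d p u ->
  lap d u zeroZ ^ 2 = 2 * INR d * exp (- Series (retlog d p)) * normsq d p.
Proof.
  intros hd hp Hsol. pose proof (wgen_lim d p u hd Hsol) as H1.
  pose proof (wgen_sq_lim d p hd hp) as H2.
  assert (H3 : is_lim_seq (fun m => wgen d p m ^ 2)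
    (lap d u zeroZ / (2 * INR d) * (lap d u zeroZ / (2 * INR d)))).
  { apply (is_lim_seq_ext (fun m => wgen d p m * wgen d p m)); [intros; ring|].
    now apply is_lim_seq_mult'. }
  apply is_lim_seq_unique in H2. apply is_lim_seq_unique in H3. rewrite H3 in H2.
  injection H2 as H2. assert (HD : INR d <> 0) by (apply not_0_INR; lia).
  apply Rmult_eq_reg_r with (/ (2 * INR d) ^ 2).
  - transitivity (lap d u zeroZ / (2 * INR d) * (lap d u zeroZ / (2 * INR d))); [now field|].
    rewrite H2. unfold sig2. now field.
  - apply Rinv_neq_0_compat, pow_nonzero. lra.
Qed.

(** * Multiple sums *)

Definition lsum (r : list Z) (g : Z -> R) : R := fold_right Rplus 0 (map g r).

Definition upd (x : nat -> Z) (i : nat) (z : Z) : nat -> Z := fun j => if Nat.eqb j i then z else x j.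

Lemma msum_S d r f : msum (S d) r f = lsum r (fun z => msum d r (fun x => f (upd x d z))).
Proof. reflexivity. Qed.

Lemma lsum_linear r : linear_fn (lsum r).
Proof.
  unfold lsum. split; intros; induction r as [|a r IH]; simpl; rewrite ?IH; ring.
Qed.

Lemma lsum_le r f g : (forall z, f z <= g z) -> lsum r f <= lsum r g.
Proof.
  intros H. unfold lsum. induction r as [|a r IH]; simpl; [lra|]. specialize (H a). lra.
Qed.

Lemma lsum_of_nat n m (h : nat -> Z) g :
  lsum (map h (seq m n)) g = sumR n (fun k => g (h (m + k)%nat)).
Proof.
  revert m. induction n as [|n IH]; intros m; [reflexivity|].
  rewrite sumR_head, Nat.add_0_r. unfold lsum in *. cbn [seq map fold_right]. rewrite IH.
  f_equal. apply sumR_ext. intros k _. do 2 f_equal. lia.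
Qed.

Lemma lsum_grid N g : lsum (grid N) g = sumR N (fun k => g (Z.of_nat k)).
Proof. unfold grid. rewrite lsum_of_nat. apply sumR_ext. reflexivity. Qed.

Lemma msum_linear d r : linear_fn (msum d r).
Proof.
  induction d as [|d [IHa IHs]]; [split; reflexivity|]. split; intros; rewrite !msum_S.
  - rewrite <- (proj1 (lsum_linear r)). f_equal. extensionality z. apply IHa.
  - rewrite <- (proj2 (lsum_linear r)). f_equal. extensionality z. apply IHs.
Qed.

Lemma msum_le d r f g : (forall x, f x <= g x) -> msum d r f <= msum d r g.
Proof.
  revert f g. induction d as [|d IH]; intros f g H; [apply H|]. rewrite !msum_S.
  apply lsum_le. intros z. apply IH. intros x. apply H.
Qed.

Lemma msum_commutes d r {T} (L : (T -> R) -> R) : linear_fn L -> commuting (msum d r) L.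
Proof.
  intros HL. induction d as [|d IH]; intros F; [reflexivity|]. rewrite msum_S.
  transitivity (lsum r (fun z => L (fun t => msum d r (fun x => F (upd x d z) t)))).
  - f_equal. extensionality z. apply (IH (fun x => F (upd x d z))).
  - unfold lsum. clear IH.
    transitivity (L (fun t => fold_right Rplus 0
      (map (fun z => msum d r (fun x => F (upd x d z) t)) r))); [|reflexivity].
    generalize r at 2 4 as l. induction l as [|a l IHl].
    + symmetry. exact (linear_fn_0 L HL).
    + cbn [map fold_right]. rewrite IHl, <- (proj1 HL). reflexivity.
Qed.

Definition eqZd (d : nat) (x y : nat -> Z) : R :=
  if forallb (fun j => Z.eqb (x j) (y j)) (seq 0 d) then 1 else 0.

Lemma eqZd_S d x y : eqZd (S d) x y = eqZd d x y * (if Z.eqb (x d) (y d) then 1 else 0).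
Proof.
  unfold eqZd. rewrite seq_S, forallb_app. cbn [forallb]. rewrite Nat.add_0_l, Bool.andb_true_r.
  destruct (forallb _ _), (Z.eqb (x d) (y d)); simpl; ring.
Qed.

Lemma forallb_seq d P : forallb P (seq 0 d) = true <-> forall j, (j < d)%nat -> P j = true.
Proof.
  rewrite forallb_forall. split; intros H j Hj; apply H.
  - apply in_seq. lia.
  - apply in_seq in Hj. lia.
Qed.

Lemma eqZd_ext d x y x' y' :
  (forall j, (j < d)%nat -> (x j = y j)%Z <-> (x' j = y' j)%Z) -> eqZd d x y = eqZd d x' y'.
Proof.
  intros H. unfold eqZd.
  assert (E : forallb (fun j => Z.eqb (x j) (y j)) (seq 0 d)
              = forallb (fun j => Z.eqb (x' j) (y' j)) (seq 0 d)).
  { apply Bool.eq_iff_eq_true. rewrite !forallb_seq. split; intros H0 j Hj;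
      apply Z.eqb_eq, (H j Hj), Z.eqb_eq, H0, Hj. }
  now rewrite E.
Qed.

Lemma eqZd_cases d x y :
  (eqZd d x y = 1 /\ forall j, (j < d)%nat -> x j = y j) \/ eqZd d x y = 0.
Proof.
  unfold eqZd. destruct (forallb _ _) eqn:E; [left|now right]. split; [reflexivity|].
  intros j Hj. apply Z.eqb_eq. now apply (proj1 (forallb_seq d _) E).
Qed.

Lemma eqZd_bounds d x y : 0 <= eqZd d x y <= 1.
Proof. unfold eqZd. destruct (forallb _ _); lra. Qed.

(** * Riemann sums of trigonometric polynomials *)

Lemma sum_cos_arith A h N : sin h <> 0 ->
  sumR N (fun k => cos (A + 2 * h * INR k))
  = (sin (A + 2 * h * INR N - h) - sin (A - h)) / (2 * sin h).
Proof.
  intros Hh. induction N as [|N IH].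
  - unfold sumR; simpl. replace (A + 2 * h * 0 - h) with (A - h) by ring. field. exact Hh.
  - rewrite sumR_S, IH, S_INR. apply Rmult_eq_reg_r with (2 * sin h); [|lra].
    replace (A + 2 * h * (INR N + 1) - h) with ((A + 2 * h * INR N) + h) by ring.
    rewrite sin_plus, sin_minus. field. exact Hh.
Qed.

(** Discrete orthogonality, exact once [N] exceeds the frequency: then [PI * z / N] is no multiple
    of [PI] unless [z = 0], so there is no aliasing. *)
Lemma sum_cos_grid N z b : (0 < N)%nat -> (Z.abs z < Z.of_nat N)%Z ->
  sumR N (fun k => cos (IZR z * (- PI + 2 * PI * IZR (Z.of_nat k) / INR N) + b))
  = INR N * cos b * (if Z.eqb z 0 then 1 else 0).
Proof.
  intros HN Hz. assert (HN' : INR N <> 0) by (apply not_0_INR; lia).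
  pose proof PI_neq0 as Hpi.
  destruct (Z.eqb_spec z 0) as [->|Hne].
  - rewrite (sumR_ext N _ (fun _ => cos b)), sumR_const; [ring|].
    intros k _. f_equal. ring.
  - set (h := PI * IZR z / INR N). set (A := - PI * IZR z + b).
    assert (Hh : sin h <> 0).
    { intros E. apply sin_eq_0_0 in E. destruct E as [k Hk].
      assert (E : IZR z = IZR (k * Z.of_nat N)).
      { rewrite mult_IZR, <- INR_IZR_INZ. apply Rmult_eq_reg_l with (PI / INR N).
        - transitivity h; [unfold h; field; exact HN'|]. rewrite Hk. field. exact HN'.
        - unfold Rdiv. apply Rmult_integral_contrapositive. split; [exact Hpi|].
          now apply Rinv_neq_0_compat. }
      apply eq_IZR in E. destruct (Z.eq_dec k 0) as [->|Hk0]; [lia|]. nia. }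
    rewrite (sumR_ext N _ (fun k => cos (A + 2 * h * INR k))).
    + rewrite sum_cos_arith by exact Hh.
      assert (E : sin (A + 2 * h * INR N - h) = sin (A - h)).
      { replace (A + 2 * h * INR N - h) with ((A - h) + 2 * (IZR z * PI))
          by (unfold h; field; exact HN').
        assert (Es : sin (IZR z * PI) = 0) by (apply sin_eq_0_1; now exists z).
        rewrite sin_plus, sin_2a, cos_2a_sin, Es. ring. }
      rewrite E. unfold Rdiv. ring.
    + intros k _. f_equal. rewrite <- INR_IZR_INZ. unfold A, h. field. exact HN'.
Qed.

Lemma phase_upd d q N x z :
  phase (S d) q (theta N (upd x d z))
  = phase d q (theta N x) + IZR (q d) * (- PI + 2 * PI * IZR z / INR N).
Proof.
  unfold phase. rewrite sumR_S. f_equal.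
  - apply sumR_ext. intros j Hj. unfold theta, upd. now destruct (Nat.eqb_spec j d); [lia|].
  - unfold theta, upd. now rewrite Nat.eqb_refl.
Qed.

Lemma msum_cos d q N b : (0 < N)%nat -> (forall j, (j < d)%nat -> (Z.abs (q j) < Z.of_nat N)%Z) ->
  msum d (grid N) (fun k => cos (phase d q (theta N k) + b)) = INR N ^ d * cos b * eqZd d q zeroZ.
Proof.
  intros HN. revert b. induction d as [|d IH]; intros b Hq.
  - unfold phase, eqZd, sumR. simpl. rewrite Rplus_0_l. ring.
  - rewrite msum_S, lsum_grid.
    rewrite (sumR_ext N _ (fun k => INR N ^ d * eqZd d q zeroZ
      * cos (IZR (q d) * (- PI + 2 * PI * IZR (Z.of_nat k) / INR N) + b))).
    + rewrite sumR_scal, sum_cos_grid by (auto; apply Hq; lia). rewrite eqZd_S.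
      unfold zeroZ. simpl. ring.
    + intros k _.
      replace (fun x => cos (phase (S d) q (theta N (upd x d (Z.of_nat k))) + b))
        with (fun x => cos (phase d q (theta N x)
          + (IZR (q d) * (- PI + 2 * PI * IZR (Z.of_nat k) / INR N) + b)))
        by (extensionality x; rewrite phase_upd; f_equal; ring).
      rewrite IH by (intros; apply Hq; lia). ring.
Qed.

(** * Fourier moments of functions of phi *)

Definition phi (d : nat) (th : nat -> R) : R := / INR d * sumR d (fun j => cos (th j)).

Lemma phi_bounds d th : (1 <= d)%nat -> -1 <= phi d th <= 1.
Proof.
  intros hd. assert (HD : 0 < INR d) by (apply lt_0_INR; lia). unfold phi.
  assert (H1 : sumR d (fun j => cos (th j)) <= sumR d (fun _ => 1))
    by (apply sumR_le; intros; apply COS_bound).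
  assert (H2 : sumR d (fun _ => -1) <= sumR d (fun j => cos (th j)))
    by (apply sumR_le; intros; apply COS_bound).
  rewrite sumR_const in H1, H2.
  split; apply Rmult_le_reg_l with (INR d); auto; rewrite <- ?Rmult_assoc, Rinv_r by lra; lra.
Qed.

Definition RSb (d : nat) (f : R -> R) (q : nat -> Z) (b : R) (N : nat) : R :=
  / (INR N ^ d) * msum d (grid N)
    (fun k => f (phi d (theta N k)) * cos (phase d q (theta N k) + b)).

(* [has_moments d f L]: the Riemann sums of f(phi) e^{-i q.theta} converge to the real numbers
   [L q]; the phase [b] handles the real part ([b = 0]) and the imaginary part ([b = PI/2]) at
   once. *)
Definition has_moments (d : nat) (f : R -> R) (L : (nat -> Z) -> R) : Prop :=
  forall q b, is_lim_seq (fun N => RSb d f q b (S N)) (L q * cos b).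

Lemma RSb_plus d f g q b N : RSb d (fun t => f t + g t) q b N = RSb d f q b N + RSb d g q b N.
Proof.
  unfold RSb. rewrite <- Rmult_plus_distr_l, <- (proj1 (msum_linear d (grid N))). f_equal. f_equal.
  extensionality k. ring.
Qed.

Lemma RSb_scal d c f q b N : RSb d (fun t => c * f t) q b N = c * RSb d f q b N.
Proof.
  unfold RSb.
  replace (fun k => c * f (phi d (theta N k)) * cos (phase d q (theta N k) + b))
    with (fun k => c * (f (phi d (theta N k)) * cos (phase d q (theta N k) + b)))
    by (extensionality k; ring).
  rewrite (proj2 (msum_linear d (grid N))). ring.
Qed.

Lemma inv_pow_ge0 d N : 0 <= / (INR N ^ d).
Proof.
  destruct (pow_le (INR N) d (pos_INR N)) as [H|H].
  - left. now apply Rinv_0_lt_compat.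
  - rewrite <- H, Rinv_0. lra.
Qed.

Lemma phase_zeroZ d th : phase d zeroZ th = 0.
Proof. apply sumR_0. intros. unfold zeroZ. ring. Qed.

Lemma RSb_abs_le d f g q b N : (1 <= d)%nat -> (forall t, -1 <= t <= 1 -> Rabs (f t) <= g t) ->
  Rabs (RSb d f q b N) <= RSb d g zeroZ 0 N.
Proof.
  intros hd H. unfold RSb.
  set (F := fun k => f (phi d (theta N k)) * cos (phase d q (theta N k) + b)).
  set (G := fun k => g (phi d (theta N k)) * cos (phase d zeroZ (theta N k) + 0)).
  assert (B : forall k, - G k <= F k <= G k).
  { intros k. unfold F, G. rewrite phase_zeroZ, Rplus_0_l, cos_0, Rmult_1_r.
    apply Rabs_le_between. rewrite Rabs_mult.
    pose proof (COS_bound (phase d q (theta N k) + b)) as Hc.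
    assert (Hc' : Rabs (cos (phase d q (theta N k) + b)) <= 1) by (apply Rabs_le; lra).
    specialize (H _ (phi_bounds d (theta N k) hd)).
    pose proof (Rabs_pos (f (phi d (theta N k)))).
    pose proof (Rabs_pos (cos (phase d q (theta N k) + b))). nra. }
  assert (B1 : msum d (grid N) F <= msum d (grid N) G) by (apply msum_le; apply B).
  assert (B2 : msum d (grid N) (fun k => -1 * G k) <= msum d (grid N) F).
  { apply msum_le. intros k. specialize (B k). lra. }
  rewrite (proj2 (msum_linear d (grid N))) in B2.
  pose proof (inv_pow_ge0 d N). apply Rabs_le. split; nra.
Qed.

Lemma bounded_coordinates d (q : nat -> Z) :
  exists M : nat, forall j, (j < d)%nat -> (Z.abs (q j) < Z.of_nat M)%Z.
Proof.
  induction d as [|d [M HM]]; [exists O; lia|].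
  exists (M + Z.to_nat (Z.abs (q d)) + 1)%nat. intros j Hj.
  destruct (Nat.eq_dec j d) as [->|Hne]; [lia|]. specialize (HM j ltac:(lia)). lia.
Qed.

Lemma has_moments_1 d : has_moments d (fun _ => 1) (fun q => eqZd d q zeroZ).
Proof.
  intros q b. destruct (bounded_coordinates d q) as [M HM].
  apply is_lim_seq_ext_loc with (fun _ => eqZd d q zeroZ * cos b); [|apply is_lim_seq_const].
  exists M. intros N HN. unfold RSb.
  replace (fun k => 1 * cos (phase d q (theta (S N) k) + b))
    with (fun k => cos (phase d q (theta (S N) k) + b)) by (extensionality k; ring).
  rewrite msum_cos by (try lia; intros j Hj; specialize (HM j Hj); lia). field.
  apply pow_nonzero, not_0_INR. lia.
Qed.

Lemma has_moments_plus d f g L M : has_moments d f L -> has_moments d g M ->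
  has_moments d (fun t => f t + g t) (fun q => L q + M q).
Proof.
  intros Hf Hg q b. apply is_lim_seq_ext with (fun N => RSb d f q b (S N) + RSb d g q b (S N)).
  - intros N. now rewrite RSb_plus.
  - rewrite Rmult_plus_distr_r. now apply is_lim_seq_plus'.
Qed.

Lemma has_moments_scal d c f L : has_moments d f L ->
  has_moments d (fun t => c * f t) (fun q => c * L q).
Proof.
  intros Hf q b. apply is_lim_seq_ext with (fun N => c * RSb d f q b (S N)).
  - intros N. now rewrite RSb_scal.
  - rewrite Rmult_assoc. apply is_lim_seq_mult'; [apply is_lim_seq_const|apply Hf].
Qed.

Lemma phase_shift d q i s th : (i < d)%nat -> phase d (shift q i s) th = phase d q th + IZR s * th i.
Proof.
  intros Hi. unfold phase.
  pose proof (sumR_single d (fun j => if Nat.eqb j i then IZR s * th j else 0) i Hi) as E.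
  cbn beta in E. rewrite Nat.eqb_refl in E. rewrite <- E.
  - rewrite <- sumR_plus. apply sumR_ext. intros j _. unfold shift.
    destruct (Nat.eqb j i); [rewrite plus_IZR; ring|ring].
  - intros j _ Hj. now apply Nat.eqb_neq in Hj as ->.
Qed.

(* Product-to-sum formula: multiplication by phi is the transition operator in [q]. *)
Lemma RSb_mul d f q b N :
  RSb d (fun t => t * f t) q b N = stepZ d (fun q => RSb d f q b N) q.
Proof.
  assert (L : linear_fn (fun F => / (INR N ^ d) * msum d (grid N) F)).
  { destruct (msum_linear d (grid N)) as [Ha Hs]. split; intros; rewrite ?Ha, ?Hs; ring. }
  unfold RSb. symmetry.
  rewrite (stepZ_commutes d _ _ (fun q k => f (phi d (theta N k))
    * cos (phase d q (theta N k) + b)) q L). f_equal. f_equal. extensionality k.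
  unfold stepZ. rewrite (sumR_ext d _ (fun i => 2 * (f (phi d (theta N k))
    * cos (phase d q (theta N k) + b)) * cos (theta N k i))).
  - rewrite sumR_scal. unfold phi. rewrite Rinv_mult. generalize (/ INR d). intros v. field.
  - intros i Hi. rewrite !phase_shift by exact Hi.
    replace (phase d q (theta N k) + 1 * theta N k i + b)
      with ((phase d q (theta N k) + b) + theta N k i) by ring.
    replace (phase d q (theta N k) + -1 * theta N k i + b)
      with ((phase d q (theta N k) + b) - theta N k i) by ring.
    rewrite cos_plus, cos_minus. ring.
Qed.

Lemma is_lim_seq_sumR n (u : nat -> nat -> R) (l : nat -> R) :
  (forall i, is_lim_seq (fun m => u i m) (l i)) ->
  is_lim_seq (fun m => sumR n (fun i => u i m)) (sumR n l).
Proof.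
  intros H. induction n as [|n IH]; [apply is_lim_seq_const|]. rewrite sumR_S.
  apply is_lim_seq_ext with (fun m => sumR n (fun i => u i m) + u n m).
  - intros m. now rewrite sumR_S.
  - apply is_lim_seq_plus'; auto.
Qed.

Lemma has_moments_mul d f L : has_moments d f L ->
  has_moments d (fun t => t * f t) (stepZ d L).
Proof.
  intros Hf q b. apply is_lim_seq_ext with (fun N => stepZ d (fun q => RSb d f q b (S N)) q).
  - intros N. symmetry. apply RSb_mul.
  - unfold stepZ.
    replace (/ (2 * INR d) * sumR d (fun i => L (shift q i 1) + L (shift q i (-1))) * cos b)
      with (/ (2 * INR d) * sumR d (fun i => L (shift q i 1) * cos b + L (shift q i (-1)) * cos b)).
    + apply is_lim_seq_mult'; [apply is_lim_seq_const|].
      apply (is_lim_seq_sumR d (fun i N => RSb d f (shift q i 1) b (S N)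
        + RSb d f (shift q i (-1)) b (S N))).
      intros i. apply is_lim_seq_plus'; apply Hf.
    + rewrite Rmult_assoc. f_equal. rewrite Rmult_comm, <- sumR_scal. apply sumR_ext.
      intros. ring.
Qed.

(** The Riemann sums have total weight 1, so uniform errors in [f] pass to them with a constant
    independent of [N]. This makes the class of functions with moments closed under uniform
    limits. *)
Lemma RSb_const_bound d f q b N delta : (1 <= d)%nat ->
  (forall t, -1 <= t <= 1 -> Rabs (f t) <= delta) -> Rabs (RSb d f q b (S N)) <= delta.
Proof.
  intros hd H. eapply Rle_trans; [apply (RSb_abs_le d f (fun _ => delta) q b (S N) hd H)|].
  right. unfold RSb.
  rewrite (proj2 (msum_linear d (grid (S N)))), msum_cos.
  - rewrite cos_0. destruct (eqZd_cases d zeroZ zeroZ) as [[-> _]|E].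
    + field. apply pow_nonzero, not_0_INR. lia.
    + exfalso. revert E. unfold eqZd.
      rewrite (proj2 (forallb_seq d (fun j => Z.eqb (zeroZ j) (zeroZ j)))); [lra|].
      intros. apply Z.eqb_refl.
  - lia.
  - intros j _. unfold zeroZ. lia.
Qed.

Lemma RSb_dist d f g q b N delta : (1 <= d)%nat ->
  (forall t, -1 <= t <= 1 -> Rabs (f t - g t) <= delta) ->
  Rabs (RSb d f q b (S N) - RSb d g q b (S N)) <= delta.
Proof.
  intros hd H.
  replace (RSb d f q b (S N) - RSb d g q b (S N))
    with (RSb d (fun t => f t + -1 * g t) q b (S N)) by (rewrite RSb_plus, RSb_scal; ring).
  apply RSb_const_bound; [exact hd|]. intros t Ht.
  replace (f t + -1 * g t) with (f t - g t) by ring. auto.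
Qed.

Lemma has_moments_approx d f L : (1 <= d)%nat ->
  (forall delta, 0 < delta -> exists g M, has_moments d g M /\
     (forall t, -1 <= t <= 1 -> Rabs (f t - g t) <= delta) /\
     (forall q, Rabs (L q - M q) <= delta)) ->
  has_moments d f L.
Proof.
  intros hd H q b. apply is_lim_seq_spec. intros eps. pose proof (cond_pos eps) as He.
  destruct (H (eps / 4) ltac:(lra)) as (g & M & Hg & Hfg & HLM).
  destruct (proj2 (is_lim_seq_spec _ _) (Hg q b) (mkposreal (eps / 4) ltac:(lra))) as [N0 HN0].
  exists N0. intros N HN. specialize (HN0 N HN). simpl in HN0. apply Rabs_lt_between in HN0.
  pose proof (RSb_dist d f g q b N (eps / 4) hd Hfg) as H1. apply Rabs_le_between in H1.
  assert (H2 : Rabs ((L q - M q) * cos b) <= eps / 4).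
  { rewrite Rabs_mult. pose proof (COS_bound b).
    assert (Rabs (cos b) <= 1) by (apply Rabs_le; lra).
    pose proof (Rabs_pos (cos b)). pose proof (Rabs_pos (L q - M q)). specialize (HLM q). nra. }
  apply Rabs_le_between in H2. rewrite Rmult_minus_distr_r in H2.
  apply Rabs_lt_between. lra.
Qed.

Lemma is_lim_seq_dist_le u v l m delta : is_lim_seq u (Finite l) -> is_lim_seq v (Finite m) ->
  (forall n, Rabs (u n - v n) <= delta) -> Rabs (l - m) <= delta.
Proof.
  intros Hu Hv H.
  apply (is_lim_seq_le (fun n => Rabs (u n - v n)) (fun _ => delta) (Rabs (l - m)) delta); [exact H| |].
  - apply (is_lim_seq_abs _ (l - m)). now apply is_lim_seq_minus'.
  - apply is_lim_seq_const.
Qed.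

Lemma has_moments_closed d f : (1 <= d)%nat ->
  (forall delta, 0 < delta -> exists g M, has_moments d g M /\
     (forall t, -1 <= t <= 1 -> Rabs (f t - g t) <= delta)) ->
  exists L, has_moments d f L.
Proof.
  intros hd H.
  assert (Hex : forall q, ex_finite_lim_seq (fun N => RSb d f q 0 (S N))).
  { intros q. apply ex_lim_seq_cauchy_corr. intros eps. pose proof (cond_pos eps) as He.
    destruct (H (eps / 4) ltac:(lra)) as (g & M & Hg & Hfg).
    destruct (proj2 (is_lim_seq_spec _ _) (Hg q 0) (mkposreal (eps / 4) ltac:(lra))) as [N0 HN0].
    exists N0. intros n m Hn Hm. pose proof (HN0 n Hn) as H1. pose proof (HN0 m Hm) as H2.
    simpl in H1, H2. apply Rabs_lt_between in H1. apply Rabs_lt_between in H2.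
    pose proof (RSb_dist d f g q 0 n (eps / 4) hd Hfg) as H3. apply Rabs_le_between in H3.
    pose proof (RSb_dist d f g q 0 m (eps / 4) hd Hfg) as H4. apply Rabs_le_between in H4.
    apply Rabs_lt_between. lra. }
  exists (fun q => real (Lim_seq (fun N => RSb d f q 0 (S N)))).
  apply has_moments_approx; [exact hd|]. intros delta Hd.
  destruct (H delta Hd) as (g & M & Hg & Hfg). exists g, M. repeat split; auto.
  intros q. apply (is_lim_seq_dist_le (fun N => RSb d f q 0 (S N)) (fun N => RSb d g q 0 (S N))).
  - now apply Lim_seq_correct'.
  - replace (M q) with (M q * cos 0) by (rewrite cos_0; ring). apply Hg.
  - intros N. now apply RSb_dist.
Qed.

(** The exponential has modulus 1, so a majorant of [f] enters only through its mean, which is its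
    moment at the origin. *)
Lemma has_moments_abs_le d f g L M q : (1 <= d)%nat -> has_moments d f L -> has_moments d g M ->
  (forall t, -1 <= t <= 1 -> Rabs (f t) <= g t) -> Rabs (L q) <= M zeroZ.
Proof.
  intros hd Hf Hg H.
  apply (is_lim_seq_le (fun N => Rabs (RSb d f q 0 (S N))) (fun N => RSb d g zeroZ 0 (S N))
          (Rabs (L q)) (M zeroZ)).
  - intros N. now apply RSb_abs_le.
  - apply (is_lim_seq_abs _ (L q)). replace (L q) with (L q * cos 0) by (rewrite cos_0; ring).
    apply Hf.
  - replace (M zeroZ) with (M zeroZ * cos 0) by (rewrite cos_0; ring). apply Hg.
Qed.

(** * Bernstein approximation *)

(** The expectation of [f] at a binomial variable with parameters [n] and [x], by conditioning on
    one trial. This recursion makes linearity, monotonicity and the variance immediate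
    inductions. *)
Fixpoint bern (n : nat) (f : nat -> R) (x : R) : R :=
  match n with
  | O => f 0%nat
  | S n' => x * bern n' (fun k => f (S k)) x + (1 - x) * bern n' f x
  end.

Lemma bern_linear n x : linear_fn (fun f => bern n f x).
Proof.
  induction n as [|n [IHa IHs]]; [split; reflexivity|]. split; intros; cbn [bern].
  - rewrite (IHa (fun k => f (S k)) (fun k => g (S k))), IHa. ring.
  - rewrite (IHs c (fun k => f (S k))), IHs. ring.
Qed.

Lemma bern_le n f g x : 0 <= x <= 1 -> (forall k, f k <= g k) -> bern n f x <= bern n g x.
Proof.
  intros Hx. revert f g. induction n as [|n IH]; intros f g H; [apply H|]. cbn [bern].
  apply Rplus_le_compat; apply Rmult_le_compat_l; try lra; apply IH; intros; apply H.
Qed.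

Lemma bern_const n c x : bern n (fun _ => c) x = c.
Proof. induction n as [|n IH]; [reflexivity|]. cbn [bern]. rewrite IH. ring. Qed.

Lemma bern_variance n c x :
  bern n (fun k => (INR k - c) ^ 2) x = INR n * (x * (1 - x)) + (INR n * x - c) ^ 2.
Proof.
  revert c. induction n as [|n IH]; intros c; [simpl; ring|]. cbn [bern].
  replace (fun k => (INR (S k) - c) ^ 2) with (fun k => (INR k - (c - 1)) ^ 2)
    by (extensionality k; rewrite S_INR; ring).
  rewrite !IH, S_INR. ring.
Qed.

(** [bern_le] compares at every natural [k], hence the Lipschitz condition for all [y >= 0] and not
    only on [[0, 1]]. *)
Lemma bern_approx (F : R -> R) K n x delta : 0 <= K -> 0 < delta -> (0 < n)%nat -> 0 <= x <= 1 ->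
  (forall y, 0 <= y -> Rabs (F y - F x) <= K * Rabs (y - x)) ->
  Rabs (bern n (fun k => F (INR k / INR n)) x - F x) <= K * (delta + / (INR n * delta)).
Proof.
  intros HK Hd Hn Hx HF. assert (HN : 0 < INR n) by now apply lt_0_INR.
  (* [|a| <= delta + a^2 / delta] with [a = k/n - x] turns the Lipschitz bound into a constant plus
     a variance. *)
  set (B := fun k : nat => K * delta + K / (INR n ^ 2 * delta) * (INR k - INR n * x) ^ 2).
  assert (HB : forall k, Rabs (F (INR k / INR n) - F x) <= B k).
  { intros k. eapply Rle_trans.
    - apply HF. apply Rmult_le_pos; [apply pos_INR|]. left. now apply Rinv_0_lt_compat.
    - unfold B. set (a := INR k / INR n - x).
      replace (K / (INR n ^ 2 * delta) * (INR k - INR n * x) ^ 2) with (K * (a ^ 2 / delta))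
        by (unfold a; field; lra).
      rewrite <- Rmult_plus_distr_l. apply Rmult_le_compat_l; [exact HK|].
      assert (Ha : a ^ 2 = Rabs a ^ 2) by (rewrite RPow_abs; symmetry; apply Rabs_pos_eq, pow2_ge_0).
      rewrite Ha. pose proof (Rabs_pos a). apply Rmult_le_reg_r with delta; [exact Hd|].
      unfold Rdiv. rewrite Rmult_plus_distr_r, (Rmult_assoc (Rabs a ^ 2)), Rinv_l by lra. nra. }
  assert (EB : bern n B x = K * delta + K / (INR n ^ 2 * delta) * (INR n * (x * (1 - x)))).
  { unfold B. rewrite (proj1 (bern_linear n x)), bern_const, (proj2 (bern_linear n x)),
      bern_variance. f_equal. f_equal. ring. }
  assert (E : Rabs (bern n (fun k => F (INR k / INR n)) x - F x) <= bern n B x).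
  { replace (bern n (fun k => F (INR k / INR n)) x - F x)
      with (bern n (fun k => F (INR k / INR n) - F x) x)
      by (rewrite (linear_fn_sub _ _ (fun _ => F x) (bern_linear n x)), bern_const; reflexivity).
    apply Rabs_le. split.
    - replace (- bern n B x) with (bern n (fun k => -1 * B k) x)
        by (rewrite (proj2 (bern_linear n x)); ring).
      apply bern_le; [exact Hx|]. intros k. specialize (HB k). apply Rabs_le_between in HB. lra.
    - apply bern_le; [exact Hx|]. intros k. specialize (HB k). apply Rabs_le_between in HB. lra. }
  eapply Rle_trans; [exact E|]. rewrite EB, Rmult_plus_distr_l. apply Rplus_le_compat_l.
  replace (K / (INR n ^ 2 * delta) * (INR n * (x * (1 - x))))
    with (K * (/ (INR n * delta) * (x * (1 - x)))) by (field; lra).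
  apply Rmult_le_compat_l; [exact HK|].
  assert (0 < / (INR n * delta)) by (apply Rinv_0_lt_compat, Rmult_lt_0_compat; lra).
  assert (x * (1 - x) <= 1) by nra. nra.
Qed.

Lemma has_moments_bern d n : forall f : nat -> R,
  exists L, has_moments d (fun t => bern n f ((1 + t) / 2)) L.
Proof.
  induction n as [|n IH]; intros f.
  - exists (fun q => f 0%nat * eqZd d q zeroZ).
    apply (eq_rect _ (fun h => has_moments d h _)
      (has_moments_scal d (f 0%nat) _ _ (has_moments_1 d))). extensionality t. simpl. ring.
  - destruct (IH (fun k => f (S k))) as [L1 H1]. destruct (IH f) as [L2 H2].
    (* With [x = (1 + t) / 2] the recursion reads [(B1 + B2) / 2 + t * (B1 - B2) / 2], built from
       sums, multiples and multiplication by [t]. *)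
    eexists. refine (eq_rect _ (fun h => has_moments d h _)
      (has_moments_plus d _ _ _ _
        (has_moments_scal d (/ 2) _ _ (has_moments_plus d _ _ _ _ H1 H2))
        (has_moments_scal d (/ 2) _ _ (has_moments_mul d _ _
          (has_moments_plus d _ _ _ _ H1 (has_moments_scal d (-1) _ _ H2))))) _ _).
    extensionality t. cbn [bern]. field.
Qed.

Lemma has_moments_lipschitz d f K : (1 <= d)%nat -> 0 <= K ->
  (forall s t, -1 <= s -> -1 <= t <= 1 -> Rabs (f s - f t) <= K * Rabs (s - t)) ->
  exists L, has_moments d f L.
Proof.
  intros hd HK Hf. apply has_moments_closed; [exact hd|]. intros eta Heta.
  set (F := fun x => f (2 * x - 1)).
  (* For [n >= 1 / delta^2] the error is at most [2K * 2 delta <= eta]; the factor 2 comes from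
     rescaling [[-1, 1]] to [[0, 1]], and the [+ 1] covers [K = 0]. *)
  set (delta := eta / (2 * (2 * K + 1))).
  assert (HD : 0 < delta) by (apply Rdiv_lt_0_compat; lra).
  destruct (INR_unbounded (/ (delta * delta))) as [n Hn].
  assert (HDD : 0 < / (delta * delta)) by (apply Rinv_0_lt_compat; nra).
  assert (Hn0 : (0 < n)%nat) by (apply INR_lt; simpl; lra).
  destruct (has_moments_bern d n (fun k => F (INR k / INR n))) as [L HL].
  eexists _, L. split; [exact HL|]. intros t Ht. cbn beta.
  assert (HN : 0 < INR n) by lra.
  assert (B : Rabs (bern n (fun k => F (INR k / INR n)) ((1 + t) / 2) - F ((1 + t) / 2))
               <= 2 * K * (delta + / (INR n * delta))).
  { apply bern_approx; try lra; [exact Hn0|]. intros y Hy. unfold F.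
    eapply Rle_trans; [apply Hf; lra|].
    replace (2 * y - 1 - (2 * ((1 + t) / 2) - 1)) with (2 * (y - (1 + t) / 2)) by field.
    rewrite Rabs_mult, (Rabs_pos_eq 2) by lra. right. ring. }
  replace (F ((1 + t) / 2)) with (f t) in B by (unfold F; f_equal; field).
  rewrite Rabs_minus_sym. eapply Rle_trans; [exact B|].
  assert (B2 : / (INR n * delta) <= delta).
  { apply Rmult_le_reg_l with (INR n * delta); [apply Rmult_lt_0_compat; lra|].
    rewrite Rinv_r by (apply Rgt_not_eq, Rmult_lt_0_compat; lra).
    assert (E : / (delta * delta) * (delta * delta) = 1) by (field; lra).
    assert (0 < delta * delta) by nra. nra. }
  apply Rle_trans with (2 * K * (2 * delta)); [apply Rmult_le_compat_l; lra|].
  replace eta with (2 * (2 * K + 1) * delta) by (unfold delta; field; lra). nra.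
Qed.

(** * Fourier coefficients of the logarithm *)

(* [hit d n q] is the probability that simple random walk goes from [q] to the origin in [n]
   steps. *)
Definition hit (d n : nat) : (nat -> Z) -> R := Nat.iter n (stepZ d) (fun x => eqZd d x zeroZ).

Lemma has_moments_pow d n : has_moments d (fun t => t ^ n) (hit d n).
Proof.
  induction n as [|n IH]; [exact (has_moments_1 d)|]. exact (has_moments_mul d _ _ IH).
Qed.

Lemma stepZ_le d f g x : (forall y, f y <= g y) -> stepZ d f x <= stepZ d g x.
Proof.
  intros H. unfold stepZ. apply Rmult_le_compat_l; [apply inv_2d_ge0|].
  apply sumR_le. intros. apply Rplus_le_compat; apply H.
Qed.

Lemma stepZ_const d c x : (1 <= d)%nat -> stepZ d (fun _ => c) x = c.
Proof. intros hd. unfold stepZ. rewrite sumR_const. field. apply not_0_INR. lia. Qed.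

Lemma hit_bounds d n q : (1 <= d)%nat -> 0 <= hit d n q <= 1.
Proof.
  intros hd. revert q. induction n as [|n IH]; intros q; [apply eqZd_bounds|].
  change (hit d (S n) q) with (stepZ d (hit d n) q). split.
  - apply Rle_trans with (1 := Req_le _ _ (eq_sym (stepZ_const d 0 q hd))).
    apply stepZ_le. apply IH.
  - apply Rle_trans with (2 := Req_le _ _ (stepZ_const d 1 q hd)). apply stepZ_le. apply IH.
Qed.

Lemma iter_stepZ_le d n f g x : (forall y, f y <= g y) ->
  Nat.iter n (stepZ d) f x <= Nat.iter n (stepZ d) g x.
Proof.
  intros H. revert x. induction n as [|n IH]; intros x; [apply H|]. apply stepZ_le. exact IH.
Qed.

Lemma iter_stepZ_ret d p n x :
  Nat.iter n (stepZ d) (fun y => ind0 (dotRZ d p y)) x = ret d p n (dotRZ d p x).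
Proof.
  revert x. induction n as [|n IH]; intros x; [reflexivity|].
  transitivity (stepZ d (fun y => ret d p n (dotRZ d p y)) x).
  - cbn [Nat.iter nat_rect]. simpl. f_equal. extensionality y. apply IH.
  - apply stepZ_dotRZ.
Qed.

Lemma hit_le_ret d p n : hit d n zeroZ <= ret d p n 0.
Proof.
  rewrite <- (dotRZ_zeroZ d p), <- iter_stepZ_ret. apply iter_stepZ_le. intros x.
  destruct (eqZd_cases d x zeroZ) as [[-> H]| ->].
  - replace (dotRZ d p x) with 0; [rewrite ind0_0; lra|].
    symmetry. apply sumR_0. intros i Hi. rewrite (H i Hi). unfold zeroZ. ring.
  - unfold ind0. destruct (Req_EM_T _ _); lra.
Qed.

Lemma pow_even_abs t n : Nat.Even n -> Rabs (t ^ n) = t ^ n.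
Proof.
  intros [k ->]. apply Rabs_pos_eq. rewrite pow_mult. apply pow_le, pow2_ge_0.
Qed.

(** An even power of [t] is its own majorant, and an odd power is bounded on [[-1, 1]] by the even
    power just below it. Adding both returns avoids tracking parity. *)
Lemma hit_S_le d n q : (1 <= d)%nat -> hit d (S n) q <= hit d (S n) zeroZ + hit d n zeroZ.
Proof.
  intros hd. pose proof (hit_bounds d (S n) zeroZ hd). pose proof (hit_bounds d n zeroZ hd).
  pose proof (Rle_abs (hit d (S n) q)). destruct (Nat.Even_or_Odd n) as [He|Ho].
  - assert (Rabs (hit d (S n) q) <= hit d n zeroZ); [|lra].
    apply (has_moments_abs_le d (fun t => t ^ S n) (fun t => t ^ n)); auto using has_moments_pow.
    intros t Ht. cbn [pow]. rewrite Rabs_mult, (pow_even_abs t n He).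
    assert (0 <= t ^ n) by (rewrite <- (pow_even_abs t n He); apply Rabs_pos).
    assert (Rabs t <= 1) by (apply Rabs_le; lra). nra.
  - assert (Rabs (hit d (S n) q) <= hit d (S n) zeroZ); [|lra].
    apply (has_moments_abs_le d (fun t => t ^ S n) (fun t => t ^ S n)); auto using has_moments_pow.
    intros t Ht. right. apply pow_even_abs. apply Nat.Even_succ, Ho.
Qed.

Definition hitlog (d : nat) (q : nat -> Z) (n : nat) : R := hit d (S n) q / INR (S n).

Lemma INR_S_ge1 n : 1 <= INR (S n).
Proof. rewrite S_INR. pose proof (pos_INR n). lra. Qed.

Lemma hitlog_ge0 d q n : (1 <= d)%nat -> 0 <= hitlog d q n.
Proof.
  intros hd. pose proof (hit_bounds d (S n) q hd). pose proof (INR_S_ge1 n).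
  apply Rmult_le_pos; [lra|]. left. apply Rinv_0_lt_compat. lra.
Qed.

(** A return to the origin forces a return of the projection along any [p]; [p = (1, ..., 1)] is a
    nonzero choice. *)
Lemma hitlog_zeroZ_summable d : (1 <= d)%nat -> ex_series (hitlog d zeroZ).
Proof.
  intros hd. apply (@ex_series_le R_AbsRing R_CompleteNormedModule _ (retlog d (fun _ => 1))).
  - intros n. change (Rabs (hitlog d zeroZ n) <= retlog d (fun _ => 1) n).
    rewrite Rabs_pos_eq by now apply hitlog_ge0. unfold hitlog, retlog.
    pose proof (INR_S_ge1 n). apply Rmult_le_compat_r.
    + left. apply Rinv_0_lt_compat. lra.
    + apply hit_le_ret.
  - apply retlog_summable; [exact hd|]. exists 0%nat. split; [lia|lra].
Qed.

Lemma hitlog_summable d q : (1 <= d)%nat -> ex_series (hitlog d q).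
Proof.
  intros hd. pose proof (hitlog_zeroZ_summable d hd) as H0.
  assert (H1 : ex_series (fun n => hit d n zeroZ / INR (S n))).
  { apply ex_series_incr_1.
    apply (@ex_series_le R_AbsRing R_CompleteNormedModule _ (hitlog d zeroZ)); [|exact H0].
    intros n. change (Rabs (hit d (S n) zeroZ / INR (S (S n))) <= hitlog d zeroZ n).
    pose proof (hit_bounds d (S n) zeroZ hd). pose proof (INR_S_ge1 n). pose proof (INR_S_ge1 (S n)).
    rewrite Rabs_pos_eq.
    - apply Rmult_le_compat_l; [lra|]. apply Rinv_le_contravar; [lra|].
      rewrite (S_INR (S n)). lra.
    - apply Rmult_le_pos; [lra|]. left. apply Rinv_0_lt_compat. lra. }
  apply (@ex_series_le R_AbsRing R_CompleteNormedModule _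
    (fun n => hitlog d zeroZ n + hit d n zeroZ / INR (S n))).
  - intros n. change (Rabs (hitlog d q n) <= hitlog d zeroZ n + hit d n zeroZ / INR (S n)).
    rewrite Rabs_pos_eq by now apply hitlog_ge0. unfold hitlog, Rdiv.
    rewrite <- Rmult_plus_distr_r. pose proof (INR_S_ge1 n). apply Rmult_le_compat_r.
    + left. apply Rinv_0_lt_compat. lra.
    + now apply hit_S_le.
  - exact (ex_series_plus _ _ H0 H1).
Qed.

Lemma has_moments_series d a : (1 <= d)%nat -> ex_series (fun n => Rabs (a n)) ->
  has_moments d (fun t => Series (fun n => a n * t ^ n)) (fun q => Series (fun n => a n * hit d n q)).
Proof.
  intros hd Ha. apply has_moments_approx; [exact hd|]. intros delta Hd.
  destruct (proj2 (is_lim_seq_spec _ _) (partial_sum_cv _ Ha) (mkposreal delta Hd)) as [N HN].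
  specialize (HN N (le_n N)). simpl in HN. apply Rabs_lt_between in HN.
  exists (fun t => sum_f_R0 (fun n => a n * t ^ n) N),
    (fun q => sum_f_R0 (fun n => a n * hit d n q) N).
  assert (B : forall c : nat -> R, (forall n, Rabs (c n) <= 1) ->
    Rabs (Series (fun n => a n * c n) - sum_f_R0 (fun n => a n * c n) N) <= delta).
  { intros c Hc. eapply Rle_trans; [apply (Series_tail_le _ (fun n => Rabs (a n)))|lra]; [|exact Ha].
    intros n. rewrite Rabs_mult. rewrite <- (Rmult_1_r (Rabs (a n))) at 2.
    apply Rmult_le_compat_l; [apply Rabs_pos|apply Hc]. }
  repeat split.
  - clear HN B. induction N as [|N IH]; [|apply has_moments_plus; [exact IH|]];
      cbn [sum_f_R0]; apply has_moments_scal, has_moments_pow.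
  - intros t Ht. apply B. intros n. rewrite <- RPow_abs, <- (pow1 n). apply pow_incr.
    split; [apply Rabs_pos|]. apply Rabs_le. lra.
  - intros q. apply B. intros n. pose proof (hit_bounds d n q hd). apply Rabs_le. lra.
Qed.

(** The case of [PSeries_exp] in which [kap] generates [1 - x] and [rho] generates [1 / (1 - x)]. *)
Lemma ln_one_minus x : Rabs x < 1 -> ln (1 - x) = - Series (fun n => / INR (S n) * x ^ S n).
Proof.
  intros Hx. set (kap := fun n => match n with O => 1 | 1%nat => -1 | _ => 0 end : R).
  assert (Hk : lin_bounded kap).
  { apply (bounded_lin _ 1). intros [|[|n]]; simpl; apply Rabs_le; lra. }
  assert (Hone : lin_bounded (fun _ => 1)).
  { apply (bounded_lin _ 1). intros. rewrite Rabs_R1. lra. }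
  assert (E : PSeries kap x = exp (- Series (fun n => 1 / INR (S n) * x ^ S n))).
  { apply (PSeries_exp kap (fun _ => 1)); auto. intros n. unfold PS_mult.
    rewrite (sum_eq _ kap) by (intros; ring). destruct n as [|n]; [simpl; ring|].
    assert (Es : sum_f_R0 kap (S n) = 0).
    { induction n as [|n IH]; [simpl; ring|]. rewrite tech5, IH. simpl. ring. }
    rewrite Es. simpl kap. ring. }
  assert (E2 : PSeries kap x = 1 - x).
  { rewrite PSeries_decr_1 by now apply lin_bounded_ex.
    assert (X : lin_bounded (PS_decr_1 kap)).
    { apply (bounded_lin _ 1). intros [|n]; unfold PS_decr_1; simpl; apply Rabs_le; lra. }
    rewrite PSeries_decr_1 by now apply lin_bounded_ex.
    rewrite (PSeries_ext _ (fun _ => 0)) by reflexivity. rewrite PSeries_const_0.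
    unfold PS_decr_1. simpl. ring. }
  rewrite <- E2, E, ln_exp. f_equal. apply Series_ext. intros n. unfold Rdiv. ring.
Qed.

(** * The truncated logarithm and its moments *)

Lemma ln_sub_le a b : 0 < a -> 0 < b -> ln a - ln b <= (a - b) / b.
Proof.
  intros Ha Hb. rewrite <- ln_div by assumption.
  replace ((a - b) / b) with (a / b - 1) by (field; lra).
  assert (H : 0 < a / b) by now apply Rdiv_lt_0_compat.
  pose proof (exp_ineq1_le (ln (a / b))) as E. rewrite exp_ln in E by exact H. lra.
Qed.

Definition logcut (eps t : R) : R := ln (Rmax (1 - t) eps).

Lemma logcut_lipschitz eps s t : 0 < eps ->
  Rabs (logcut eps s - logcut eps t) <= / eps * Rabs (s - t).
Proof.
  intros He. unfold logcut.
  assert (B : forall a b, Rmax a eps - Rmax b eps <= Rabs (a - b)).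
  { intros a b. pose proof (Rle_abs (a - b)). pose proof (Rabs_pos (a - b)).
    unfold Rmax. destruct (Rle_dec a eps), (Rle_dec b eps); lra. }
  assert (C : forall a b, ln (Rmax a eps) - ln (Rmax b eps) <= / eps * Rabs (a - b)).
  { intros a b. pose proof (Rmax_r a eps). pose proof (Rmax_r b eps).
    eapply Rle_trans; [apply ln_sub_le; lra|]. unfold Rdiv. rewrite Rmult_comm.
    specialize (B a b). pose proof (Rabs_pos (a - b)).
    assert (0 < / Rmax b eps) by (apply Rinv_0_lt_compat; lra).
    assert (/ Rmax b eps <= / eps) by (apply Rinv_le_contravar; lra).
    apply Rle_trans with (/ Rmax b eps * Rabs (a - b)); [apply Rmult_le_compat_l; lra|].
    apply Rmult_le_compat_r; lra. }
  pose proof (C (1 - s) (1 - t)) as C1. pose proof (C (1 - t) (1 - s)) as C2.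
  replace (1 - s - (1 - t)) with (- (s - t)) in C1 by ring.
  replace (1 - t - (1 - s)) with (s - t) in C2 by ring. rewrite Rabs_Ropp in C1.
  apply Rabs_le. lra.
Qed.

(* The error is a multiple of the resolvent kernel [1 / (1 - s t)], whose integral against phi is
   the Green function [sum s^n hit n 0]. *)
Lemma logcut_resolvent eps t : 0 < eps <= 1 / 2 -> -1 <= t <= 1 ->
  Rabs (logcut eps t - ln (1 - (1 - eps) * t)) <= 2 * eps * / (1 - (1 - eps) * t).
Proof.
  intros He Ht. unfold logcut. set (A := Rmax (1 - t) eps). set (B := 1 - (1 - eps) * t).
  assert (HB : 0 < B) by (unfold B; nra).
  assert (HA : 0 < A) by (pose proof (Rmax_r (1 - t) eps); unfold A; lra).
  (* [B = (1 - t) + eps * t] is within [eps] of [A], and at most [(1 - t) + eps], hence at most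
     [2 A]. *)
  assert (H1 : - eps <= A - B <= eps).
  { unfold A, B, Rmax. destruct (Rle_dec (1 - t) eps); nra. }
  assert (H2 : B <= 2 * A).
  { unfold A, B, Rmax. destruct (Rle_dec (1 - t) eps); nra. }
  pose proof (ln_sub_le A B HA HB) as L1. pose proof (ln_sub_le B A HB HA) as L2.
  assert (HiB : 0 < / B) by now apply Rinv_0_lt_compat.
  assert (HiA : 0 < / A) by now apply Rinv_0_lt_compat.
  assert (M1 : (A - B) / B <= 2 * eps * / B).
  { unfold Rdiv. apply Rmult_le_compat_r; lra. }
  assert (M2 : (B - A) / A <= 2 * eps * / B).
  { apply Rle_trans with (eps * / A); [unfold Rdiv; apply Rmult_le_compat_r; lra|].
    apply Rmult_le_reg_r with (A * B); [now apply Rmult_lt_0_compat|].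
    replace (eps * / A * (A * B)) with (eps * B) by (field; lra).
    replace (2 * eps * / B * (A * B)) with (eps * (2 * A)) by (field; lra).
    apply Rmult_le_compat_l; lra. }
  apply Rabs_le. lra.
Qed.

(** The Green function itself may diverge as [s -> 1]. By [pow_mul_bound], [eps * s^n <= 1 / n], so
    the terms at times [n >= 1] are dominated by the summable [hitlog d zeroZ]; time 0 is split
    off. *)
Lemma green_abel_lim d : (1 <= d)%nat ->
  is_lim_seq (fun m => eps_seq m * Series (fun n => (1 - eps_seq m) ^ n * hit d n zeroZ)) 0.
Proof.
  intros hd.
  set (f := fun m n => eps_seq m * (1 - eps_seq m) ^ S n * hit d (S n) zeroZ).
  apply is_lim_seq_ext with (fun m => eps_seq m * hit d 0 zeroZ + Series (f m)).
  - intros m. pose proof (eps_seq_bounds m) as He.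
    assert (Hex : ex_series (fun n => (1 - eps_seq m) ^ n * hit d n zeroZ)).
    { apply (ex_series_ext (fun n => hit d n zeroZ * (1 - eps_seq m) ^ n)); [intros; apply Rmult_comm|].
      apply ex_pseries_R, lin_bounded_ex.
      - apply (bounded_lin _ 1). intros n. pose proof (hit_bounds d n zeroZ hd). apply Rabs_le. lra.
      - apply Rabs_lt_between; lra. }
    rewrite (Series_incr_1 (fun n => (1 - eps_seq m) ^ n * hit d n zeroZ)) by exact Hex.
    rewrite Rmult_plus_distr_l, <- Series_scal_l. simpl pow at 1.
    rewrite Rmult_1_l. f_equal. apply Series_ext. intros n. unfold f. ring.
  - replace (Finite 0) with (Finite (0 * hit d 0 zeroZ + Series (fun _ => 0))).
    + apply is_lim_seq_plus'.
      * apply is_lim_seq_mult'; [apply eps_seq_lim|apply is_lim_seq_const].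
      * apply (tannery f (fun _ => 0) (hitlog d zeroZ)); [now apply hitlog_zeroZ_summable| |].
        -- intros m n. pose proof (eps_seq_bounds m) as He.
           pose proof (hit_bounds d (S n) zeroZ hd) as Hh. pose proof (INR_S_ge1 n) as HS.
           pose proof (one_minus_eps_pow_bounds m (S n)) as Hp.
           pose proof (pow_mul_bound (1 - eps_seq m) (S n) ltac:(lra)) as Hb.
           unfold f, hitlog. rewrite Rabs_pos_eq.
           ++ apply Rmult_le_reg_r with (INR (S n)); [lra|].
              unfold Rdiv. rewrite (Rmult_assoc (hit d (S n) zeroZ)), Rinv_l, Rmult_1_r by lra.
              set (P := (1 - eps_seq m) ^ S n) in *. set (h := hit d (S n) zeroZ) in *.
              replace (eps_seq m * P * h * INR (S n))
                with ((INR (S n) * P * (1 - (1 - eps_seq m))) * h) by ring. nra.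
           ++ apply Rmult_le_pos; [apply Rmult_le_pos; lra|lra].
        -- intros n. unfold f.
           replace (Finite 0) with (Finite (0 * 1 * hit d (S n) zeroZ)) by (f_equal; ring).
           apply is_lim_seq_mult'; [|apply is_lim_seq_const].
           apply is_lim_seq_mult'; [apply eps_seq_lim|apply one_minus_eps_pow_lim].
    + f_equal. rewrite Rmult_0_l, Rplus_0_l.
      rewrite (Series_ext _ (fun n => 0 * 0)) by (intros; ring). rewrite Series_scal_l. ring.
Qed.

Definition fourier_re (d : nat) (q : nat -> Z) : R := - Series (hitlog d q).

(** The cut logarithm is replaced by [ln (1 - s t)] with [s = 1 - eps], whose moments are explicit;
    [logcut_resolvent] bounds the moments of the difference by the Green function at the origin. *)
Lemma logcut_moments d m : (1 <= d)%nat -> exists L, has_moments d (logcut (eps_seq m)) L /\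
  forall q, Rabs (L q + Series (fun n => hitlog d q n * (1 - eps_seq m) ^ S n))
     <= 2 * (eps_seq m * Series (fun n => (1 - eps_seq m) ^ n * hit d n zeroZ)).
Proof.
  intros hd. pose proof (eps_seq_bounds m) as He. set (eps := eps_seq m) in *.
  set (s := 1 - eps). assert (Hs : 0 < s < 1) by (unfold s; lra).
  assert (Hs' : Rabs s < 1) by (apply Rabs_lt_between; lra).
  destruct (has_moments_lipschitz d (logcut eps) (/ eps) hd) as [L HL].
  { left. apply Rinv_0_lt_compat. lra. }
  { intros. apply logcut_lipschitz. lra. }
  exists L. split; [exact HL|]. intros q.
  assert (Habs : forall c : nat -> R, (forall n, Rabs (c n) <= 1) ->
    ex_series (fun n => Rabs (c n * s ^ n))).
  { intros c Hc. apply CV_disk_inside, lin_bounded_radius; [|exact Hs'].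
    now apply (bounded_lin _ 1). }
  assert (Ex : forall c : nat -> R, ex_series (fun n => Rabs (c n)) -> ex_series c)
    by (intros c Hc; now apply ex_series_Rabs).
  (* The logarithmic series indexed from 0: [/ INR 0 = 0] makes the constant term vanish. *)
  set (a := fun n => / INR n * s ^ n).
  assert (Hinv : forall n, Rabs (/ INR n) <= 1).
  { intros [|n]; [simpl; rewrite Rinv_0, Rabs_R0; lra|]. pose proof (INR_S_ge1 n).
    rewrite Rabs_pos_eq by (left; apply Rinv_0_lt_compat; lra).
    rewrite <- Rinv_1. apply Rinv_le_contravar; lra. }
  assert (Hsh : forall c : nat -> R, (forall n, Rabs (c n) <= 1) ->
    Series (fun n => a n * c n) = Series (fun n => / INR (S n) * c (S n) * s ^ S n)).
  { intros c Hc. rewrite Series_incr_1.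
    - replace (a 0%nat) with 0 by (unfold a; simpl; rewrite Rinv_0; ring).
      rewrite Rmult_0_l, Rplus_0_l. apply Series_ext. intros n. unfold a. ring.
    - apply Ex. apply ex_series_ext with (fun n => Rabs ((/ INR n * c n) * s ^ n)).
      + intros n. f_equal. unfold a. ring.
      + apply Habs. intros n. rewrite Rabs_mult. specialize (Hc n). specialize (Hinv n).
        pose proof (Rabs_pos (c n)). pose proof (Rabs_pos (/ INR n)). nra. }
  assert (Hpow : forall t, -1 <= t <= 1 -> forall n, Rabs (t ^ n) <= 1).
  { intros t Ht n. rewrite <- RPow_abs, <- (pow1 n). apply pow_incr.
    split; [apply Rabs_pos|]. apply Rabs_le. lra. }
  assert (Hhit : forall n, Rabs (hit d n q) <= 1).
  { intros n. pose proof (hit_bounds d n q hd). apply Rabs_le. lra. }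
  pose proof (has_moments_series d a hd (Habs _ Hinv)) as M1.
  assert (M2 : has_moments d (fun t => 2 * eps * Series (fun n => s ^ n * t ^ n))
    (fun q => 2 * eps * Series (fun n => s ^ n * hit d n q))).
  { apply has_moments_scal, has_moments_series; [exact hd|].
    apply ex_series_ext with (fun n => Rabs (1 * s ^ n)); [intros; f_equal; ring|].
    apply (Habs (fun _ => 1)). intros. rewrite Rabs_R1. lra. }
  replace (Series (fun n => hitlog d q n * s ^ S n)) with (Series (fun n => a n * hit d n q)).
  - rewrite <- Rmult_assoc.
    apply (has_moments_abs_le d _ _ _ _ q hd (has_moments_plus d _ _ _ _ HL M1) M2).
    intros t Ht. cbn beta.
    assert (Hst : Rabs (s * t) < 1) by (apply Rabs_lt_between; nra).
    rewrite (Series_ext (fun n => s ^ n * t ^ n) (fun n => (s * t) ^ n))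
      by (intros n; symmetry; apply Rpow_mult_distr).
    rewrite Series_geom by exact Hst. rewrite (Hsh (fun n => t ^ n) (Hpow t Ht)).
    rewrite (Series_ext _ (fun n => / INR (S n) * (s * t) ^ S n))
      by (intros n; rewrite Rpow_mult_distr; ring).
    replace (Series (fun n => / INR (S n) * (s * t) ^ S n)) with (- ln (1 - s * t))
      by (rewrite ln_one_minus by exact Hst; ring).
    apply (logcut_resolvent eps t); lra.
  - rewrite (Hsh (fun n => hit d n q) Hhit). apply Series_ext. intros n. unfold hitlog, Rdiv. ring.
Qed.

Lemma is_Fourier_log d q : (1 <= d)%nat -> is_Fourier d q (fourier_re d q) 0.
Proof.
  intros hd. exists (fun m => real (Lim_seq (fun N => RS_re d (/ INR (m + 2)) q (S N)))), (fun _ => 0).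
  assert (A : forall m, exists l, is_lim_seq (fun N => RS_re d (/ INR (m + 2)) q (S N)) (Finite l) /\
    Rabs (l + Series (fun n => hitlog d q n * (1 - eps_seq m) ^ S n))
     <= 2 * (eps_seq m * Series (fun n => (1 - eps_seq m) ^ n * hit d n zeroZ))).
  { intros m. destruct (logcut_moments d m hd) as (L & HL & HB). exists (L q). split; [|apply HB].
    replace (Finite (L q)) with (Finite (L q * cos 0)) by (rewrite cos_0; f_equal; ring).
    apply is_lim_seq_ext with (2 := HL q 0). intros N. unfold RSb, RS_re. do 2 f_equal.
    extensionality k. rewrite Rplus_0_r. reflexivity. }
  repeat split.
  - intros m. apply is_lim_seq_Reals. destruct (A m) as (l & Hl & _). cbn beta.
    now rewrite (is_lim_seq_unique _ _ Hl).
  - intros m. apply is_lim_seq_Reals. destruct (logcut_moments d m hd) as (L & HL & _).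
    (* Since [cos (x + PI/2) = - sin x], the phase [PI/2] produces the imaginary part, and its limit
       carries the factor [cos (PI/2) = 0]. *)
    replace (Finite 0) with (Finite (L q * cos (PI / 2))) by (rewrite cos_PI2; f_equal; ring).
    apply is_lim_seq_ext with (2 := HL q (PI / 2)). intros N. unfold RSb, RS_im. do 2 f_equal.
    extensionality k. rewrite cos_plus, cos_PI2, sin_PI2.
    change (Strunc d (/ INR (m + 2)) (theta (S N) k))
      with (logcut (eps_seq m) (phi d (theta (S N) k))). ring.
  - apply is_lim_seq_Reals.
    set (T := fun m => Series (fun n => hitlog d q n * (1 - eps_seq m) ^ S n)).
    set (G := fun m => eps_seq m * Series (fun n => (1 - eps_seq m) ^ n * hit d n zeroZ)).
    assert (HT : is_lim_seq T (Series (hitlog d q))).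
    { apply (tannery _ _ (hitlog d q)); [now apply hitlog_summable| |].
      - intros m n. pose proof (hitlog_ge0 d q n hd) as H1.
        pose proof (one_minus_eps_pow_bounds m (S n)) as H2.
        rewrite Rabs_pos_eq by (apply Rmult_le_pos; lra).
        rewrite <- (Rmult_1_r (hitlog d q n)) at 2. apply Rmult_le_compat_l; lra.
      - intros n. replace (Finite (hitlog d q n)) with (Finite (hitlog d q n * 1)) by (f_equal; ring).
        apply is_lim_seq_mult'; [apply is_lim_seq_const|apply one_minus_eps_pow_lim]. }
    pose proof (green_abel_lim d hd) as HG. fold G in HG.
    apply (is_lim_seq_le_le (fun m => - T m - 2 * G m) _ (fun m => - T m + 2 * G m)).
    + intros m. destruct (A m) as (l & Hl & HB). cbn beta.
      rewrite (is_lim_seq_unique _ _ Hl). fold (T m) in HB. fold (G m) in HB.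
      apply Rabs_le_between in HB. simpl. lra.
    + unfold fourier_re.
      replace (Finite (- Series (hitlog d q))) with (Finite (- Series (hitlog d q) - 2 * 0))
        by (f_equal; ring).
      apply is_lim_seq_minus'; [now apply is_lim_seq_opp in HT|].
      apply is_lim_seq_mult'; [apply is_lim_seq_const|exact HG].
    + unfold fourier_re.
      replace (Finite (- Series (hitlog d q))) with (Finite (- Series (hitlog d q) + 2 * 0))
        by (f_equal; ring).
      apply is_lim_seq_plus'; [now apply is_lim_seq_opp in HT|].
      apply is_lim_seq_mult'; [apply is_lim_seq_const|exact HG].
  - apply is_lim_seq_Reals, is_lim_seq_const.
Qed.

(** * Summation over the lattice orthogonal to [p] *)

Lemma iter_stepZ_linear d n x : linear_fn (fun f => Nat.iter n (stepZ d) f x).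
Proof.
  revert x. induction n as [|n IH]; intros x; [split; reflexivity|].
  split; intros; simpl.
  - rewrite <- (proj1 (stepZ_linear d x)). f_equal. extensionality y. apply IH.
  - rewrite <- (proj2 (stepZ_linear d x)). f_equal. extensionality y. apply IH.
Qed.

Lemma eqZd_shift d x q i s : eqZd d (shift x i s) q = eqZd d x (shift q i (- s)).
Proof.
  apply eqZd_ext. intros j _. unfold shift. destruct (Nat.eqb j i); lia.
Qed.

(** Reversibility of the walk: the [n]-step transition probability is symmetric in its endpoints. *)
Lemma iter_stepZ_swap d n x q :
  Nat.iter n (stepZ d) (fun y => eqZd d y q) x = Nat.iter n (stepZ d) (fun r => eqZd d x r) q.
Proof.
  revert q. induction n as [|n IH]; intros q; [reflexivity|].
  transitivity (Nat.iter n (stepZ d) (stepZ d (fun y => eqZd d y q)) x).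
  { now rewrite Nat.iter_swap. }
  transitivity (Nat.iter n (stepZ d) (fun y => stepZ d (fun r => eqZd d y r) q) x).
  { f_equal. extensionality y. unfold stepZ. f_equal. apply sumR_ext. intros i _.
    rewrite !eqZd_shift. apply Rplus_comm. }
  rewrite <- (stepZ_commutes d _ (fun f => Nat.iter n (stepZ d) f x) (fun r y => eqZd d y r) q
                (iter_stepZ_linear d n x)).
  simpl. f_equal. extensionality r. apply IH.
Qed.

Definition inbox (d M : nat) (x : nat -> Z) : R :=
  if forallb (fun j => Z.leb (Z.abs (x j)) (Z.of_nat M)) (seq 0 d) then 1 else 0.

Lemma lsum_box M z0 : lsum (box M) (fun z => if Z.eqb z z0 then 1 else 0)
  = if Z.leb (Z.abs z0) (Z.of_nat M) then 1 else 0.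
Proof.
  unfold box. rewrite lsum_of_nat. destruct (Z.leb_spec (Z.abs z0) (Z.of_nat M)) as [H|H].
  - rewrite (sumR_single _ _ (Z.to_nat (z0 + Z.of_nat M))); [|lia|].
    + destruct (Z.eqb_spec (Z.of_nat (0 + Z.to_nat (z0 + Z.of_nat M)) - Z.of_nat M) z0);
        [reflexivity|lia].
    + intros i Hi Hne. destruct (Z.eqb_spec (Z.of_nat (0 + i) - Z.of_nat M) z0); [lia|reflexivity].
  - apply sumR_0. intros i Hi.
    destruct (Z.eqb_spec (Z.of_nat (0 + i) - Z.of_nat M) z0); [lia|reflexivity].
Qed.

Lemma msum_box_eqZd d M x : msum d (box M) (fun q => eqZd d q x) = inbox d M x.
Proof.
  induction d as [|d IH]; [reflexivity|]. rewrite msum_S.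
  transitivity (lsum (box M) (fun z => inbox d M x * (if Z.eqb z (x d) then 1 else 0))).
  - f_equal. extensionality z. rewrite <- IH, Rmult_comm.
    rewrite <- (proj2 (msum_linear d (box M))). f_equal. extensionality q.
    rewrite eqZd_S, Rmult_comm. f_equal.
    + unfold upd. now rewrite Nat.eqb_refl.
    + apply eqZd_ext. intros j Hj. unfold upd. destruct (Nat.eqb_spec j d); [lia|reflexivity].
  - rewrite (proj2 (lsum_linear (box M))), lsum_box. unfold inbox.
    rewrite seq_S, forallb_app. cbn [forallb]. rewrite Nat.add_0_l, Bool.andb_true_r.
    destruct (forallb _ _), (Z.leb _ _); simpl; ring.
Qed.

Lemma boxsum_linear d p M : linear_fn (boxsum d p M).
Proof.
  unfold boxsum. split; intros.
  - rewrite <- (proj1 (msum_linear d (box M))). f_equal. extensionality q.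
    destruct (Req_EM_T _ _); ring.
  - rewrite <- (proj2 (msum_linear d (box M))). f_equal. extensionality q.
    destruct (Req_EM_T _ _); ring.
Qed.

(** Reversibility turns a sum over starting points [q] of the walk into one expectation for the walk
    from the origin, with the condition on [q] becoming a test function. *)
Lemma boxsum_hit d p M n : boxsum d p M (hit d n)
  = Nat.iter n (stepZ d) (fun x => ind0 (dotRZ d p x) * inbox d M x) zeroZ.
Proof.
  unfold boxsum.
  transitivity (msum d (box M) (fun q => Nat.iter n (stepZ d)
    (fun x => ind0 (dotRZ d p q) * eqZd d q x) zeroZ)).
  - f_equal. extensionality q. rewrite (proj2 (iter_stepZ_linear d n zeroZ)).
    rewrite <- iter_stepZ_swap. fold (hit d n).
    unfold ind0. destruct (Req_EM_T _ _); unfold hit; ring.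
  - etransitivity; [apply (msum_commutes d (box M) _ (iter_stepZ_linear d n zeroZ))|].
    f_equal. extensionality x. rewrite <- msum_box_eqZd, <- (proj2 (msum_linear d (box M))).
    f_equal. extensionality q. destruct (eqZd_cases d q x) as [[-> H]| ->]; [|ring].
    replace (dotRZ d p q) with (dotRZ d p x); [ring|].
    apply sumR_ext. intros i Hi. now rewrite H.
Qed.

(** Finite speed: each step changes one coordinate by 1. *)
Lemma iter_stepZ_local d n f g m x :
  (forall y, (forall j, (j < d)%nat -> (Z.abs (y j) <= Z.of_nat (m + n))%Z) -> f y = g y) ->
  (forall j, (j < d)%nat -> (Z.abs (x j) <= Z.of_nat m)%Z) ->
  Nat.iter n (stepZ d) f x = Nat.iter n (stepZ d) g x.
Proof.
  revert m x. induction n as [|n IH]; intros m x H Hx.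
  - apply H. now rewrite Nat.add_0_r.
  - simpl. unfold stepZ at 1 3. f_equal. apply sumR_ext. intros i _.
    f_equal; (apply (IH (S m)); [intros y Hy; apply H; intros j Hj; specialize (Hy j Hj); lia|]);
      intros j Hj; specialize (Hx j Hj); unfold shift; destruct (Nat.eqb j i); lia.
Qed.

Lemma boxsum_hit_bounds d p M n : (1 <= d)%nat -> 0 <= boxsum d p M (hit d n) <= ret d p n 0.
Proof.
  intros hd. assert (Hi : forall x, 0 <= inbox d M x <= 1)
    by (intros x; unfold inbox; destruct (forallb _ _); lra).
  assert (H0 : forall x, 0 <= ind0 (dotRZ d p x))
    by (intros x; unfold ind0; destruct (Req_EM_T _ _); lra).
  rewrite boxsum_hit. split.
  - rewrite <- (linear_fn_0 _ (iter_stepZ_linear d n zeroZ)) at 1. apply iter_stepZ_le.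
    intros y. apply Rmult_le_pos; [apply H0|apply Hi].
  - rewrite <- (dotRZ_zeroZ d p), <- iter_stepZ_ret. apply iter_stepZ_le. intros y.
    rewrite <- (Rmult_1_r (ind0 (dotRZ d p y))) at 2. apply Rmult_le_compat_l; [apply H0|apply Hi].
Qed.

(** In [n <= M] steps the walk cannot leave the box, so no limit in [M] is involved for a fixed [n];
    [boxsum_hit_bounds] supplies the domination over [n]. *)
Lemma boxsum_hit_eq d p M n : (n <= M)%nat -> boxsum d p M (hit d n) = ret d p n 0.
Proof.
  intros HM. rewrite boxsum_hit, <- (dotRZ_zeroZ d p) at 1. rewrite <- iter_stepZ_ret.
  apply (iter_stepZ_local d n _ _ 0).
  - intros y Hy. unfold inbox.
    rewrite (proj2 (forallb_seq d (fun j => Z.leb (Z.abs (y j)) (Z.of_nat M)))); [ring|].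
    intros j Hj. apply Z.leb_le. specialize (Hy j Hj). lia.
  - intros j _. unfold zeroZ. lia.
Qed.

Lemma boxsum_hitlog d p M n :
  boxsum d p M (fun q => hitlog d q n) = / INR (S n) * boxsum d p M (hit d (S n)).
Proof.
  rewrite <- (proj2 (boxsum_linear d p M)). f_equal. extensionality q. unfold hitlog, Rdiv. ring.
Qed.

Lemma boxsum_hitlog_bounds d p M n : (1 <= d)%nat ->
  0 <= boxsum d p M (fun q => hitlog d q n) <= retlog d p n.
Proof.
  intros hd. rewrite boxsum_hitlog. pose proof (boxsum_hit_bounds d p M (S n) hd).
  pose proof (INR_S_ge1 n). assert (0 < / INR (S n)) by (apply Rinv_0_lt_compat; lra).
  unfold retlog, Rdiv. rewrite (Rmult_comm (ret d p (S n) 0)). split.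
  - apply Rmult_le_pos; lra.
  - apply Rmult_le_compat_l; lra.
Qed.

Lemma msum_is_series d r (F : (nat -> Z) -> nat -> R) (l : (nat -> Z) -> R) :
  (forall q, is_series (F q) (l q)) -> is_series (fun n => msum d r (fun q => F q n)) (msum d r l).
Proof.
  revert F l. induction d as [|d IH]; intros F l H; [apply H|]. rewrite msum_S.
  unfold lsum.
  assert (G : forall r', is_series (fun n => fold_right Rplus 0
    (map (fun z => msum d r (fun x => F (upd x d z) n)) r'))
    (fold_right Rplus 0 (map (fun z => msum d r (fun x => l (upd x d z))) r'))).
  { induction r' as [|a r' IHr].
    - cbn [map fold_right]. apply is_series_Reals. intros eps He. exists 0%nat. intros k _.
      rewrite sum_cte, Rmult_0_l, R_dist_eq. exact He.
    - cbn [map fold_right]. apply (is_series_plus _ _ _ _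
        (IH (fun x => F (upd x d a)) (fun x => l (upd x d a)) (fun x => H (upd x d a))) IHr). }
  exact (G r).
Qed.

Lemma boxsum_Series d p M : (1 <= d)%nat ->
  boxsum d p M (fun q => Series (hitlog d q))
  = Series (fun n => boxsum d p M (fun q => hitlog d q n)).
Proof.
  intros hd. symmetry. apply is_series_unique.
  apply (msum_is_series d (box M)
    (fun q n => if Req_EM_T (dotRZ d p q) 0 then hitlog d q n else 0)).
  intros q. destruct (Req_EM_T (dotRZ d p q) 0).
  - apply Series_correct. now apply hitlog_summable.
  - apply is_series_Reals. intros eps He. exists 0%nat. intros k _.
    rewrite sum_cte, Rmult_0_l, R_dist_eq. exact He.
Qed.

Lemma boxsum_Series_lim d p : (1 <= d)%nat -> (exists i, (i < d)%nat /\ p i <> 0) ->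
  is_lim_seq (fun M => boxsum d p M (fun q => Series (hitlog d q))) (Series (retlog d p)).
Proof.
  intros hd hp.
  apply is_lim_seq_ext with (fun M => Series (fun n => boxsum d p M (fun q => hitlog d q n))).
  { intros M. symmetry. now apply boxsum_Series. }
  apply (tannery _ _ (retlog d p)); [now apply retlog_summable| |].
  - intros M n. pose proof (boxsum_hitlog_bounds d p M n hd). rewrite Rabs_pos_eq; lra.
  - intros n. apply is_lim_seq_ext_loc with (fun _ => retlog d p n); [|apply is_lim_seq_const].
    exists (S n). intros M HM. rewrite boxsum_hitlog, boxsum_hit_eq by exact HM.
    unfold retlog, Rdiv. apply Rmult_comm.
Qed.

Lemma boxsum_Series_le d p M : (1 <= d)%nat -> (exists i, (i < d)%nat /\ p i <> 0) ->
  boxsum d p M (fun q => Series (hitlog d q)) <= Series (retlog d p).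
Proof.
  intros hd hp. rewrite boxsum_Series by exact hd. apply Series_le; [|now apply retlog_summable].
  intros n. now apply boxsum_hitlog_bounds.
Qed.

Theorem mainTheorem1 (d : nat) (hd : (1 <= d)%nat) (p : nat -> R)
  (hp : exists i, (i < d)%nat /\ p i <> 0) :
  exists re im : (nat -> Z) -> R,
    (forall q, inZd d q -> is_Fourier d q (re q) (im q)) /\
    (exists B, forall M, boxsum d p M (fun q => sqrt (re q ^ 2 + im q ^ 2)) <= B) /\
    exists Lre Lim : R,
      Un_cv (fun M => boxsum d p M re) Lre /\
      Un_cv (fun M => boxsum d p M im) Lim /\
      forall u, is_sol d p u ->
        (lap d u zeroZ) ^ 2 = 2 * INR d * (exp Lre * cos Lim) * normsq d p /\
        0 = 2 * INR d * (exp Lre * sin Lim) * normsq d p.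
Proof.
  exists (fourier_re d), (fun _ => 0). split; [|split].
  - intros q _. now apply is_Fourier_log.
  (* Every coefficient is real and nonpositive, so its modulus is [Series (hitlog d q)]. *)
  - exists (Series (retlog d p)). intros M.
    replace (fun q => sqrt (fourier_re d q ^ 2 + 0 ^ 2)) with (fun q => Series (hitlog d q)).
    + now apply boxsum_Series_le.
    + extensionality q. unfold fourier_re.
      replace ((- Series (hitlog d q)) ^ 2 + 0 ^ 2) with (Series (hitlog d q) ^ 2) by ring.
      symmetry. apply sqrt_pow2. apply Series_ge0; [|now apply hitlog_summable].
      intros n. now apply hitlog_ge0.
  - exists (- Series (retlog d p)), 0. split; [|split].
    + apply is_lim_seq_Reals.
      apply is_lim_seq_ext with (fun M => - boxsum d p M (fun q => Series (hitlog d q))).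
      * intros M. transitivity (-1 * boxsum d p M (fun q => Series (hitlog d q))); [ring|].
        rewrite <- (proj2 (boxsum_linear d p M)). f_equal. extensionality q.
        unfold fourier_re. ring.
      * pose proof (boxsum_Series_lim d p hd hp) as H. now apply is_lim_seq_opp in H.
    + apply is_lim_seq_Reals. apply is_lim_seq_ext with (fun _ => 0); [|apply is_lim_seq_const].
      intros M. symmetry. apply (linear_fn_0 _ (boxsum_linear d p M)).
    + intros u Hu. rewrite cos_0, sin_0. split; [|ring].
      rewrite (hamiltonian_sq d p u hd hp Hu). ring.
Qed.
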